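(* Let $m,p,n\geq1$, $T>0$, let $\mathcal{A}_1,\dots,\mathcal{A}_n\in\mathbb{C}^{m\times m\times p}$ be fixed Hermitian T-product tensors, and let $\mathcal{X}_1,\dots,\mathcal{X}_n\in\mathbb{C}^{m\times m\times p}$ be independent random Hermitian T-product tensors such that for each $i$, $$\mathbb{E}\mathcal{X}_i=\mathcal{O}\quad\text{and}\quad\mathbb{E}(\mathcal{X}_i^k)\preceq\frac{k!\,T^{k-2}}{2}\mathcal{A}_i^2\quad\text{for all }k=2,3,4,\dots.$$ Let $\sigma^2=\left\Vert\sum_{i=1}^n\mathcal{A}_i^2\right\Vert$. Then for $\theta\ge0$, $$\Pr\left(\lambda_{\max}\left(\sum_{i=1}^n\mathcal{X}_i\right)\geq\theta\right)\leq mp\exp\left(\frac{-\theta^2/2}{\sigma^2+T\theta}\right);$$ moreover $$\Pr\left(\lambda_{\max}\left(\sum_{i=1}^n\mathcal{X}_i\right)\geq\theta\right)\leq mp\exp\left(\frac{-\theta^2}{4\sigma^2}\right)\quad\text{for }\theta\leq\sigma^2/T,$$ and $$\Pr\left(\lambda_{\max}\left(\sum_{i=1}^n\mathcal{X}_i\right)\geq\theta\right)\leq mp\exp\left(\frac{-\theta}{4T}\right)\quad\text{for }\theta\geq\sigma^2/T.$$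
   Context: For $\mathcal{A}\in\mathbb{C}^{m\times n\times p}$ with frontal slices $A^{(1)},\dots,A^{(p)}$, $\mathrm{bcirc}(\mathcal{A})\in\mathbb{C}^{mp\times np}$ is the block circulant matrix whose $(r,s)$ block is $A^{(((r-s)\bmod p)+1)}$. The T-product $\mathcal{A}\star\mathcal{B}$ is the tensor with $\mathrm{bcirc}(\mathcal{A}\star\mathcal{B})=\mathrm{bcirc}(\mathcal{A})\mathrm{bcirc}(\mathcal{B})$; powers $\mathcal{A}^k$ are T-product powers. The conjugate transpose $\mathcal{A}^{\mathrm H}$ is obtained by conjugate-transposing every frontal slice and reversing the order of slices $2,\dots,p$. $\mathcal{A}\in\mathbb{C}^{m\times m\times p}$ is Hermitian if $\mathcal{A}^{\mathrm H}=\mathcal{A}$; its eigenvalues are the $mp$ eigenvalues of $\mathrm{bcirc}(\mathcal{A})$, with largest $\lambda_{\max}$. For Hermitian $\mathcal{A},\mathcal{B}$, $\mathcal{A}\preceq\mathcal{B}$ means $\mathrm{bcirc}(\mathcal{B}-\mathcal{A})$ is positive semidefinite. $\Vert\mathcal{A}\Vert$ is the largest singular value of $\mathrm{bcirc}(\mathcal{A})$. $\mathcal{O}$ is the zero tensor; expectation is entrywise. *)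

(* Defs.v *)
From HB Require Import structures.
From mathcomp Require Import all_boot all_order all_algebra.
From mathcomp Require Import complex.
From mathcomp Require Import all_classical all_reals all_analysis.
Set Implicit Arguments. Unset Strict Implicit. Unset Printing Implicit Defensive.
Import Order.TTheory GRing.Theory Num.Theory.
Local Open Scope classical_set_scope.
Local Open Scope ring_scope.
Local Open Scope complex_scope.

Section Tensors.
Variable R : realType.
Local Notation C := (R[i]).

(* A third-order tensor in C^{m x m x p}: its p frontal slices (0-based). *)
Definition tensor (m p : nat) := {ffun 'I_p -> 'M[C]_m}.

(* Entry (k, a, b) of a tensor, read off from natural-number indices;
   0 outside the range (never used out of range below). *)
Definition tent m p (A : tensor m p) (k a b : nat) : C :=
  match @insub _ (fun i : nat => i < p)%N 'I_p k,
        @insub _ (fun i : nat => i < m)%N 'I_m a,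
        @insub _ (fun i : nat => i < m)%N 'I_m b with
  | Some k', Some a', Some b' => A k' a' b'
  | _, _, _ => 0
  end.

(* bcirc(A) in C^{mp x mp}: row index r*m+a (block r, inner row a),
   column index s*m+b; block (r,s) is the slice ((r-s) mod p). *)
Definition bcirc m p (A : tensor m p) : 'M[C]_(m * p) :=
  \matrix_(i, j) tent A ((i %/ m + p - j %/ m) %% p) (i %% m) (j %% m).

(* T-product (Kilmer--Martin): A * B = fold(bcirc(A) unfold(B)), i.e.
   slice k is sum_j A^((k-j) mod p) B^(j); equivalently the tensor with
   bcirc(A * B) = bcirc(A) bcirc(B). *)
Definition tprod m p (A B : tensor m p) : tensor m p :=
  [ffun k : 'I_p => \sum_(j < p)
     (\matrix_(a, b) tent A ((k + p - j) %% p) a b) *m B j].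

Definition tid m p : tensor m p :=
  [ffun k : 'I_p => if (k == 0 :> nat) then 1%:M else 0].

Definition tpow m p (A : tensor m p) (k : nat) : tensor m p :=
  iter k (tprod A) (tid m p).

Definition ctr n (M : 'M[C]_n) : 'M[C]_n := (map_mx Num.conj M)^T.

(* conjugate transpose of a tensor: conjugate-transpose every slice and
   reverse the order of slices 2..p *)
Definition tconjT m p (A : tensor m p) : tensor m p :=
  [ffun k : 'I_p => ctr (\matrix_(a, b) tent A ((p - k) %% p) a b)].

Definition thermitian m p (A : tensor m p) : Prop := tconjT A = A.

Definition psd n (M : 'M[C]_n) : Prop :=
  ctr M = M /\ forall v : 'rV[C]_n, 0 <= (v *m M *m (map_mx Num.conj v)^T) 0 0.

Definition tle m p (A B : tensor m p) : Prop := psd (bcirc (B - A)).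

Definition lambda_max n (M : 'M[C]_n) : R := sup [set x : R | eigenvalue M x%:C].

Definition tlmax m p (A : tensor m p) : R := lambda_max (bcirc A).

Definition tnorm m p (A : tensor m p) : R :=
  Num.sqrt (lambda_max (ctr (bcirc A) *m bcirc A)).

End Tensors.

Section RandomTensors.
Context {R : realType} {d : measure_display} {Omega : measurableType d}.
Variable P : probability Omega R.
Local Notation C := (R[i]).

Definition texp m p (X : Omega -> tensor R m p) : tensor R m p :=
  [ffun k : 'I_p => \matrix_(a, b)
     Complex (fine (\int[P]_w (complex.Re (X w k a b))%:E))
             (fine (\int[P]_w (complex.Im (X w k a b))%:E))].

Definition tintegrable m p (X : Omega -> tensor R m p) : Prop :=
  forall (k : 'I_p) (a b : 'I_m),
    P.-integrable setT (fun w => (complex.Re (X w k a b))%:E) /\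
    P.-integrable setT (fun w => (complex.Im (X w k a b))%:E).

Definition tmeasurable m p (X : Omega -> tensor R m p) : Prop :=
  forall (k : 'I_p) (a b : 'I_m),
    measurable_fun setT (fun w => complex.Re (X w k a b)) /\
    measurable_fun setT (fun w => complex.Im (X w k a b)).

Definition tsigma m p (X : Omega -> tensor R m p) : set (set Omega) :=
  <<s [set A | exists (k : 'I_p) (a b : 'I_m) (B : set R), measurable B /\
          (A = (fun w => complex.Re (X w k a b)) @^-1` B \/
           A = (fun w => complex.Im (X w k a b)) @^-1` B)] >>.

(* mutual independence of the family X_1..X_n (taking E i = setT for the
   indices outside a subfamily gives the product rule for every subfamily) *)
Definition tindependent n m p (X : 'I_n -> Omega -> tensor R m p) : Prop :=
  forall E : 'I_n -> set Omega, (forall i, tsigma (X i) (E i)) ->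
    P (\bigcap_(i in [set: 'I_n]) E i) = (\prod_(i < n) P (E i))%E.

End RandomTensors.

(* Main.v *)
Require Import Defs.
From HB Require Import structures.
From mathcomp Require Import all_boot all_order all_algebra.
From mathcomp Require Import complex ring lra.
From mathcomp Require Import all_classical all_reals all_analysis.
From mathcomp Require Import measurable_realfun.
Set Implicit Arguments. Unset Strict Implicit. Unset Printing Implicit Defensive.
Import Order.TTheory GRing.Theory Num.Theory.
Import numFieldNormedType.Exports.
Local Open Scope classical_set_scope.
Local Open Scope ring_scope.
Local Open Scope complex_scope.

(* With [S] the sum of the [X_i] and [g = t^2 / (2 (1 - t T))], the moment
   hypotheses give [E exp(t X_i) <= 1 + g A_i^2] for [0 <= t < 1/T].  For a fixed
   Hermitian [H], Golden-Thompson yields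
     [E tr exp(H + t X_i) <= tr exp(H) E exp(t X_i) <= tr exp(H) (1 + g A_i^2)],
   and Klein's inequality (convexity of [tr exp]) bounds the right-hand side by
   [tr exp(H + g A_i^2)].  By independence the summands can be replaced one at a
   time, so [E tr exp(t S) <= tr exp(g sum_i A_i^2) <= m p exp(g sigma^2)] without
   Lieb's concavity theorem.  Markov's inequality with
   [t = theta / (sigma^2 + T theta)] (or [t = 1 / (2 T)] if [sigma = 0]) gives
   the first bound, which implies the other two.

   Matrix exponentials are handled as limits of [(1 + M / N)^N]: these are
   polynomial in the entries of [M], and for even [N] nonnegative on Hermitian
   matrices, so that Fatou's lemma passes the moment bounds to the limit. *)

(** * Complex scalars *)

Section ComplexScalars.
Variable R : realType.
Local Notation C := (R[i]).
Local Notation Re := (@complex.Re R).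
Local Notation Im := (@complex.Im R).

Lemma Re_add (x y : C) : Re (x + y) = Re x + Re y.
Proof. by case: x y => [a b] [c d]. Qed.

Lemma Im_add (x y : C) : Im (x + y) = Im x + Im y.
Proof. by case: x y => [a b] [c d]. Qed.

Lemma Re_mul (x y : C) : Re (x * y) = Re x * Re y - Im x * Im y.
Proof. by case: x y => [a b] [c d]. Qed.

Lemma Im_mul (x y : C) : Im (x * y) = Re x * Im y + Im x * Re y.
Proof. by case: x y => [a b] [c d]. Qed.

Lemma Re_sum I (r : seq I) (Q : pred I) (F : I -> C) :
  Re (\sum_(i <- r | Q i) F i) = \sum_(i <- r | Q i) Re (F i).
Proof. exact: (big_morph Re Re_add (erefl _)). Qed.

Lemma Re_realM (a : R) (x : C) : Re (a%:C * x) = a * Re x.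
Proof. by rewrite Re_mul /= mul0r subr0. Qed.

Lemma conjE (x : C) : Num.conj x = Complex (Re x) (- Im x).
Proof. by case: x. Qed.

Definition nsq (x : C) : R := Re x ^+ 2 + Im x ^+ 2.

Lemma nsq_ge0 x : 0 <= nsq x.
Proof. by rewrite addr_ge0 ?sqr_ge0. Qed.

Lemma mul_conj (x : C) : x * Num.conj x = (nsq x)%:C.
Proof.
case: x => a b; rewrite conjE /nsq /=; apply/eqP; rewrite eq_complex /=.
by apply/andP; split; apply/eqP; ring.
Qed.

Lemma complex_ge0 (x : C) : 0 <= x -> 0 <= Re x.
Proof. by rewrite lecE /= => /andP[]. Qed.

End ComplexScalars.

(** * Spectral calculus of Hermitian matrices *)

Section Spectral.
Variable R : realType.
Local Notation C := (R[i]).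
Local Notation Re := (@complex.Re R).
Local Notation Im := (@complex.Im R).

Definition hadj m n (M : 'M[C]_(m, n)) : 'M[C]_(n, m) := (map_mx Num.conj M)^T.

Lemma hadjK m n (M : 'M[C]_(m, n)) : hadj (hadj M) = M.
Proof. by apply/matrixP => i j; rewrite !mxE conjCK. Qed.

Lemma hadj_mul m n p (M : 'M[C]_(m, n)) (N : 'M[C]_(n, p)) :
  hadj (M *m N) = hadj N *m hadj M.
Proof. by rewrite /hadj map_mxM trmx_mul. Qed.

Lemma hadjD m n (M N : 'M[C]_(m, n)) : hadj (M + N) = hadj M + hadj N.
Proof. by apply/matrixP => i j; rewrite !mxE rmorphD. Qed.

Lemma hadj_sum m n I (r : seq I) (Q : pred I) (F : I -> 'M[C]_(m, n)) :
  hadj (\sum_(i <- r | Q i) F i) = \sum_(i <- r | Q i) hadj (F i).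
Proof.
apply: (big_morph _ (@hadjD m n)).
by apply/matrixP => i j; rewrite !mxE rmorph0.
Qed.

Lemma hadjZ m n (a : R) (M : 'M[C]_(m, n)) : hadj (a%:C *: M) = a%:C *: hadj M.
Proof.
apply/matrixP => i j; rewrite !mxE rmorphM /=; congr (_ * _).
by rewrite conjE /= oppr0.
Qed.

Lemma hadj_scalar n (a : R) : hadj (a%:C%:M : 'M[C]_n) = a%:C%:M.
Proof.
apply/matrixP => i j; rewrite !mxE eq_sym rmorphMn /=; congr (_ *+ _).
by rewrite conjE /= oppr0.
Qed.

Lemma hadj1 n : hadj (1%:M : 'M[C]_n) = 1%:M.
Proof. exact: (hadj_scalar n 1). Qed.

Lemma hadjX n (M : 'M[C]_n) k : hadj M = M -> hadj (M ^+ k) = M ^+ k.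
Proof.
move=> hM; elim: k => [|k IH]; first by rewrite expr0 hadj1.
rewrite exprSr -[X in hadj X]/(_ *m _) hadj_mul IH hM.
by rewrite -[_ *m _]/(M * M ^+ k) -exprS exprSr.
Qed.

Definition unitary n (U : 'M[C]_n) := U *m hadj U = 1%:M.

Lemma unitary_adj n (U : 'M[C]_n) : unitary U -> unitary (hadj U).
Proof. by move=> hU; rewrite /unitary hadjK; exact: mulmx1C. Qed.

Lemma unitaryM n (U V : 'M[C]_n) : unitary U -> unitary V -> unitary (U *m V).
Proof.
move=> hU hV; rewrite /unitary hadj_mul mulmxA -(mulmxA U) hV mulmx1.
exact: hU.
Qed.

Definition spec n (U : 'M[C]_n) (s : 'I_n -> R) : 'M[C]_n :=
  hadj U *m diag_mx (\row_i (s i)%:C) *m U.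

Section Fixed.
Variables (n : nat) (U : 'M[C]_n).
Hypothesis hU : unitary U.

Lemma spec_mul s t : spec U s *m spec U t = spec U (fun i => s i * t i).
Proof.
rewrite /spec !mulmxA -(mulmxA _ U) hU mulmx1 -(mulmxA (hadj U)) mulmx_diag.
congr (_ *m diag_mx _ *m _); apply/rowP => i; rewrite !mxE.
by rewrite -rmorphM.
Qed.

Lemma specD s t : spec U s + spec U t = spec U (fun i => s i + t i).
Proof.
rewrite /spec -mulmxDl -mulmxDr -raddfD /=.
congr (_ *m diag_mx _ *m _); apply/rowP => i; rewrite !mxE.
by rewrite -rmorphD.
Qed.

Lemma specZ a s : a%:C *: spec U s = spec U (fun i => a * s i).
Proof.
rewrite /spec scalemxAl scalemxAr -linearZ /=.
congr (_ *m diag_mx _ *m _); apply/rowP => i; rewrite !mxE.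
by rewrite -rmorphM.
Qed.

Lemma spec1 : spec U (fun=> 1) = 1%:M.
Proof.
rewrite /spec (_ : diag_mx _ = 1%:M) ?mulmx1; first exact: mulmx1C.
by apply/matrixP => i j; rewrite !mxE.
Qed.

Lemma specX s k : spec U s ^+ k = spec U (fun i => s i ^+ k).
Proof.
elim: k => [|k IH]; first by rewrite expr0 -[1]/(1%:M) -spec1.
rewrite exprS IH -[LHS]/(_ *m _) spec_mul; congr spec.
by apply/funext => i; rewrite exprS.
Qed.

Lemma hadj_spec s : hadj (spec U s) = spec U s.
Proof.
rewrite /spec !hadj_mul hadjK mulmxA; congr (_ *m _ *m _).
apply/matrixP => i j; rewrite !mxE eq_sym.
case: eqP => [->|_]; rewrite ?mulr1n ?mulr0n ?rmorph0 //.
by rewrite conjE /= oppr0.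
Qed.

End Fixed.

Definition rtr n (M : 'M[C]_n) : R := Re (\tr M).

Definition qf n (u : 'rV[C]_n) (M : 'M[C]_n) : R := Re ((u *m M *m hadj u) 0 0).

Lemma rtr_spec n (U : 'M[C]_n) s : unitary U -> rtr (spec U s) = \sum_i s i.
Proof.
move=> hU; rewrite /rtr /spec mxtrace_mulC mulmxA hU mul1mx mxtrace_diag Re_sum.
by apply: eq_bigr => i _; rewrite mxE.
Qed.

Lemma qf_row n (U M : 'M[C]_n) i : qf (row i U) M = Re ((U *m M *m hadj U) i i).
Proof.
rewrite /qf; congr Re.
rewrite -row_mul !mxE; apply: eq_bigr => j _.
by rewrite !mxE.
Qed.

Lemma rtr_spec_mul n (U M : 'M[C]_n) s :
  rtr (spec U s *m M) = \sum_i s i * qf (row i U) M.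
Proof.
rewrite /rtr /spec -mulmxA mxtrace_mulC mulmxA.
rewrite mxtrace_mulC mul_diag_mx Re_sum.
apply: eq_bigr => i _; rewrite mxE mxE Re_realM.
by rewrite qf_row.
Qed.

Lemma qf_spec n (u : 'rV[C]_n) (V : 'M[C]_n) t :
  qf u (spec V t) = \sum_j t j * nsq ((u *m hadj V) 0 j).
Proof.
rewrite /qf /spec !mulmxA -(mulmxA _ V) -{2}(hadjK V) -hadj_mul mul_mx_diag.
rewrite mxE Re_sum; apply: eq_bigr => j _.
by rewrite !mxE mulrAC mul_conj -rmorphM /= mulrC.
Qed.

Lemma qfD n (u : 'rV[C]_n) M N : qf u (M + N) = qf u M + qf u N.
Proof. by rewrite /qf mulmxDr mulmxDl mxE Re_add. Qed.

Lemma qfZ n (u : 'rV[C]_n) a M : qf u (a%:C *: M) = a * qf u M.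
Proof. by rewrite /qf -scalemxAr -scalemxAl mxE Re_realM. Qed.

Lemma sum_nsq_unitary n (U : 'M[C]_n) i : unitary U -> \sum_j nsq (U i j) = 1.
Proof.
move=> hU; have := congr1 (fun M : 'M[C]_n => Re (M i i)) hU.
rewrite !mxE eqxx /= Re_sum => <-; apply: eq_bigr => j _.
by rewrite !mxE mul_conj.
Qed.

Lemma sum_nsq_unitaryC n (U : 'M[C]_n) j : unitary U -> \sum_i nsq (U i j) = 1.
Proof.
move=> /unitary_adj/(@sum_nsq_unitary _ _ j) <-; apply: eq_bigr => i _.
by rewrite !mxE conjE /nsq /= sqrrN.
Qed.

End Spectral.

(** * Euler limit of the exponential *)

Section ExpLimit.
Variable R : realType.

Lemma cvg_sumr (I : Type) (r : seq I) (f : I -> nat -> R) (l : I -> R) :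
  (forall i, f i @ \oo --> l i) ->
  (fun k => \sum_(i <- r) f i k) @ \oo --> \sum_(i <- r) l i.
Proof.
move=> h; elim: r => [|a r IH].
  by rewrite big_nil; under eq_fun do rewrite big_nil; exact: cvg_cst.
rewrite big_cons; under eq_fun do rewrite big_cons.
exact: cvgD.
Qed.

Lemma bernoulli_le (y : R) n : y <= 1 -> 1 - n%:R * y <= (1 - y) ^+ n.
Proof.
move=> y1; elim: n => [|n IH]; first by rewrite mul0r subr0 expr0.
have h : 0 <= 1 - y by rewrite subr_ge0.
rewrite exprSr; apply: le_trans (ler_wpM2r h IH).
have : 0 <= n%:R * y ^+ 2 by rewrite mulr_ge0 ?sqr_ge0.
rewrite -natr1; nra.
Qed.

Lemma expR_approx_le (x : R) n : 0 <= 1 + x / n.+1%:R ->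
  (1 + x / n.+1%:R) ^+ n.+1 <= expR x.
Proof.
move=> h.
have -> : expR x = expR (x / n.+1%:R) ^+ n.+1.
  by rewrite -expRM_natl mulr_natl -mulr_natr divfK.
by rewrite lerXn2r ?nnegrE ?expR_ge0 //; exact: expR_ge1Dx.
Qed.

Lemma expR_approx_ge (x : R) n : `|x| <= n.+1%:R ->
  expR x * (1 - x ^+ 2 / n.+1%:R) <= (1 + x / n.+1%:R) ^+ n.+1.
Proof.
move=> hx; set N : R := n.+1%:R in hx *; have N0 : 0 < N by rewrite ltr0n.
set y := x / N.
have hy : `|y| <= 1 by rewrite /y normrM normfV (gtr0_norm N0) ler_pdivrMr ?mul1r.
have [y1 y2] : -1 <= y /\ y <= 1 by apply/andP; rewrite -ler_norml.
have h1 : (1 - y) ^+ n.+1 <= expR (- x).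
  have := @expR_approx_le (- x) n; rewrite mulNr; apply.
  by rewrite subr_ge0.
have h2 : expR x * (1 - y) ^+ n.+1 <= 1.
  by apply: le_trans (ler_wpM2l (expR_ge0 x) h1) _; rewrite -expRD subrr expR0.
have h3 : 1 - x ^+ 2 / N <= (1 - y) ^+ n.+1 * (1 + y) ^+ n.+1.
  rewrite -exprMn (_ : (1 - y) * (1 + y) = 1 - y ^+ 2); last by ring.
  have -> : x ^+ 2 / N = n.+1%:R * y ^+ 2.
    by rewrite -/N /y expr_div_n [N ^+ 2]expr2; field; rewrite gt_eqF.
  by apply: bernoulli_le; rewrite -(real_normK (num_real y)) expr_le1.
have h4 : 0 <= (1 + y) ^+ n.+1 by rewrite exprn_ge0 //; lra.
apply: le_trans (ler_wpM2l (expR_ge0 x) h3) _.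
by rewrite mulrA -[leRHS]mul1r; exact: ler_wpM2r.
Qed.

Lemma invn_cvg0 : (fun k => (2 ^ k.+1)%:R^-1 : R) @ \oo --> (0 : R).
Proof.
have -> : (fun k => (2 ^ k.+1)%:R^-1 : R) = (fun k => 2^-1 * 2^-1 ^+ k).
  by apply/funext => k; rewrite natrX -exprVn exprS.
rewrite -[X in _ --> X](mulr0 2^-1).
apply: cvgMl_tmp; apply: cvg_expr.
by rewrite gtr0_norm ?invr_gt0 // invf_lt1 // ltr1n.
Qed.

Lemma expR_cvg (x : R) :
  (fun k => (1 + x / (2 ^ k.+1)%:R) ^+ (2 ^ k.+1)) @ \oo --> expR x.
Proof.
have hS k : exists n, (2 ^ k.+1 = n.+1)%N.
  by exists (2 ^ k.+1).-1; rewrite prednK ?expn_gt0.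
have big : \forall k \near \oo, `|x| <= (2 ^ k.+1)%:R.
  have := invn_cvg0 => /cvgrPdist_lt /(_ (1 + `|x|)^-1).
  have hp : 0 < 1 + `|x| by rewrite ltr_pwDl.
  rewrite invr_gt0 => /(_ hp); apply: filterS => k.
  rewrite sub0r normrN gtr0_norm ?invr_gt0 ?ltr0n ?expn_gt0 //.
  rewrite ltf_pV2 ?posrE ?ltr0n ?expn_gt0 // => /ltW; apply: le_trans.
  by rewrite lerDr.
apply: (@squeeze_cvgr _ _ _ _ (fun k => expR x * (1 - x ^+ 2 * (2 ^ k.+1)%:R^-1))
  (cst (expR x))).
- near=> k.
  have hk : `|x| <= (2 ^ k.+1)%:R by near: k.
  have [n hn] := hS k; rewrite hn in hk *.
  rewrite expR_approx_ge // expR_approx_le //.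
  rewrite -lerBlDl sub0r.
  by rewrite ler_pdivlMr ?ltr0n // mulN1r; move: hk; rewrite ler_norml => /andP[].
- rewrite -[X in _ --> X](mulr1 (expR x)); apply: cvgMl_tmp.
  rewrite -[X in _ --> X](subr0 1) -(mulr0 (x ^+ 2)).
  by apply: cvgB; [exact: cvg_cst | apply: cvgMl_tmp; exact: invn_cvg0].
- exact: cvg_cst.
Unshelve. all: by end_near.
Qed.

End ExpLimit.

(** * The Golden-Thompson and Klein inequalities *)

Section TraceInequality.
Variables (R : realType) (n : nat).
Local Notation C := (R[i]).
Local Notation Re := (@complex.Re R).
Implicit Types A B Y : 'M[C]_n.

Lemma rtrD A B : rtr (A + B) = rtr A + rtr B.
Proof. by rewrite /rtr mxtraceD Re_add. Qed.

Lemma rtrN A : rtr (- A) = - rtr A.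
Proof. by rewrite /rtr raddfN /=; case: (\tr A). Qed.

Lemma rtrC A B : rtr (A * B) = rtr (B * A).
Proof. by rewrite /rtr -[A * B]/(A *m B) mxtrace_mulC. Qed.

Lemma rtr_adj A : rtr (hadj A) = rtr A.
Proof.
rewrite /rtr /hadj mxtrace_tr !Re_sum; apply: eq_bigr => i _.
by rewrite mxE conjE.
Qed.

Lemma hadjM A B : hadj (A * B) = hadj B * hadj A.
Proof. exact: hadj_mul. Qed.

Lemma hadjN A : hadj (- A) = - hadj A.
Proof. by apply/matrixP => i j; rewrite !mxE rmorphN. Qed.

Lemma rtr_adj_ge0 A : 0 <= rtr (A * hadj A).
Proof.
rewrite /rtr Re_sum; apply: sumr_ge0 => i _.
rewrite mxE Re_sum; apply: sumr_ge0 => j _.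
by rewrite !mxE mul_conj nsq_ge0.
Qed.

Lemma rtr_sqr_le Y : rtr (Y ^+ 2) <= rtr (Y * hadj Y).
Proof.
have := rtr_adj_ge0 (Y - hadj Y).
rewrite hadjD hadjN hadjK mulrDl !mulrDr !mulrN !mulNr opprK !rtrD !rtrN.
have -> : rtr (hadj Y * hadj Y) = rtr (Y * Y) by rewrite -hadjM rtr_adj.
by rewrite (rtrC (hadj Y)) expr2; lra.
Qed.

Lemma rtr_mul_le A B : hadj A = A -> hadj B = B ->
  rtr (A * B) <= (rtr (A ^+ 2) + rtr (B ^+ 2)) / 2.
Proof.
move=> hA hB; have := rtr_adj_ge0 (A - B).
rewrite hadjD hadjN hA hB mulrDl !mulrDr !mulrN !mulNr opprK !rtrD !rtrN.
by rewrite (rtrC B) !expr2; lra.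
Qed.

Lemma rtr_exprC A B k : rtr ((A * B) ^+ k) = rtr ((B * A) ^+ k).
Proof.
case: k => [|k]; first by rewrite !expr0.
have -> : (A * B) ^+ k.+1 = A * (B * A) ^+ k * B.
  elim: k => [|k IH]; first by rewrite expr0 expr1 mulr1.
  by rewrite exprS IH [in RHS]exprS !mulrA.
by rewrite rtrC mulrA -exprS.
Qed.

(* The two inequalities feed each other: the first, applied to [Y ^+ 2],
   calls the second on [Y Y^*] and [Y^* Y]; the second, for [k.+1], calls the
   first on [A * B]. *)
Lemma rtr_expr2_le k :
  (forall Y, rtr (Y ^+ (2 ^ k.+1)) <= rtr ((Y * hadj Y) ^+ (2 ^ k))) /\
  (forall A B, hadj A = A -> hadj B = B ->
     rtr ((A * B) ^+ (2 ^ k)) <= rtr (A ^+ (2 ^ k) * B ^+ (2 ^ k))).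
Proof.
elim: k => [|k [IH1 IH2]]; split.
- by move=> Y; rewrite expn1 expn0 expr1; exact: rtr_sqr_le.
- by move=> A B _ _; rewrite expn0 !expr1.
- move=> Y; rewrite expnS exprM; apply: le_trans (IH1 _) _.
  rewrite expr2 hadjM -mulrA rtr_exprC -!mulrA (mulrA Y).
  apply: le_trans (IH2 _ _ _ _) _; rewrite ?hadjM ?hadjK //.
  apply: le_trans (rtr_mul_le _ _) _; rewrite ?hadjX ?hadjM ?hadjK //.
  by rewrite -!exprM -expnSr (rtr_exprC (hadj Y)); lra.
- move=> A B hA hB; apply: le_trans (IH1 _) _.
  rewrite hadjM hA hB -mulrA rtr_exprC -!mulrA (mulrA B).
  rewrite rtr_exprC -!expr2.
  apply: le_trans (IH2 _ _ _ _) _; rewrite ?hadjX //.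
  by rewrite -!exprM -expnS.
Qed.

End TraceInequality.

Section EntrywiseNorm.
Variables (R : realType) (n : nat).
Local Notation C := (R[i]).
Local Notation Re := (@complex.Re R).
Local Notation normc := (@Normc.normc R).
Implicit Types A B : 'M[C]_n.

Definition nrm A : R := \sum_i \sum_j normc (A i j).

Lemma normr_normc (x : C) : `|x| = (normc x)%:C. Proof. by []. Qed.

Lemma normc_ge0 (x : C) : 0 <= normc x.
Proof. by case: x => a b; rewrite sqrtr_ge0. Qed.

Lemma normcD (x y : C) : normc (x + y) <= normc x + normc y.
Proof. by have := ler_normD x y; rewrite !normr_normc -rmorphD lecR. Qed.

Lemma normc_sum I (r : seq I) (Q : pred I) (F : I -> C) :
  normc (\sum_(i <- r | Q i) F i) <= \sum_(i <- r | Q i) normc (F i).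
Proof.
have := ler_norm_sum r F Q; rewrite normr_normc -lecR rmorph_sum /=.
by move/le_trans; apply; rewrite ler_sum.
Qed.

Lemma nrm_ge0 A : 0 <= nrm A.
Proof. by do 2!apply: sumr_ge0 => ? _; exact: normc_ge0. Qed.

Lemma nrmD A B : nrm (A + B) <= nrm A + nrm B.
Proof.
rewrite /nrm -big_split; apply: ler_sum => i _ /=.
rewrite -big_split; apply: ler_sum => j _ /=.
by rewrite mxE normcD.
Qed.

Lemma nrmM A B : nrm (A * B) <= nrm A * nrm B.
Proof.
rewrite /nrm mulr_suml; apply: ler_sum => i _.
apply: (@le_trans _ _ (\sum_j \sum_k normc (A i k) * normc (B k j))).
  apply: ler_sum => j _; rewrite mxE.
  apply: le_trans (normc_sum _ _ _) _; apply: ler_sum => k _.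
  by rewrite Normc.normcM.
rewrite exchange_big /= mulr_suml; apply: ler_sum => k _.
rewrite -mulr_sumr ler_wpM2l ?normc_ge0 //.
rewrite [leRHS](bigD1 k) //= lerDl; apply: sumr_ge0 => l _.
by apply: sumr_ge0 => ? _; exact: normc_ge0.
Qed.

Lemma nrmZ (a : R) A : nrm (a%:C *: A) = `|a| * nrm A.
Proof.
rewrite /nrm mulr_sumr; apply: eq_bigr => i _.
rewrite mulr_sumr; apply: eq_bigr => j _.
by rewrite mxE Normc.normcM /= expr0n addr0 sqrtr_sqr.
Qed.

Lemma rtr_le_nrm A : `|rtr A| <= nrm A.
Proof.
rewrite /rtr Re_sum; apply: le_trans (ler_norm_sum _ _ _) _.
apply: ler_sum => i _; rewrite (bigD1 i) //=.
rewrite -[leLHS]addr0 lerD //; last by apply: sumr_ge0 => ? _; exact: normc_ge0.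
by rewrite -lecR -normr_normc; exact: normc_ge_Re.
Qed.

Lemma nrm_expr_1D A (c : R) k : nrm A <= c ->
  nrm ((1 + A) ^+ k) <= nrm (1 : 'M[C]_n) * (1 + c) ^+ k.
Proof.
move=> hA; have c1 : 0 <= 1 + c.
  by apply: addr_ge0 => //; apply: le_trans hA; exact: nrm_ge0.
elim: k => [|k IH]; first by rewrite !expr0 mulr1.
rewrite !exprSr mulrDr mulr1 mulrA; apply: le_trans (nrmD _ _) _.
apply: (@le_trans _ _ (nrm ((1 + A) ^+ k) * (1 + c))); last exact: ler_wpM2r.
rewrite mulrDr mulr1 lerD //; apply: le_trans (nrmM _ _) _.
by rewrite ler_wpM2l ?nrm_ge0.
Qed.

Lemma nrm_expr_sub A B (c : R) k : nrm A <= c -> nrm B <= c ->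
  nrm ((1 + A) ^+ k - (1 + B) ^+ k) <=
    k%:R * nrm (1 : 'M[C]_n) * (1 + c) ^+ k * nrm (A - B).
Proof.
move=> hA hB; have c0 : 0 <= c by apply: le_trans hA; exact: nrm_ge0.
elim: k => [|k IH].
  rewrite !expr0 subrr /nrm !mul0r big1 // => i _.
  by rewrite big1 // => j _; rewrite mxE Normc.normc0.
have -> : (1 + A) ^+ k.+1 - (1 + B) ^+ k.+1 =
    ((1 + A) ^+ k - (1 + B) ^+ k) * (1 + A) + (1 + B) ^+ k * (A - B).
  have -> : A - B = (1 + A) - (1 + B) by rewrite opprD addrACA subrr add0r.
  by rewrite !exprSr mulrBl mulrBr addrA subrK.
set N1 := nrm 1 in IH *.
have N10 : 0 <= N1 by exact: nrm_ge0.
have h1 := nrm_ge0 (A - B).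
have h2 : 0 <= (1 + c) ^+ k by apply: exprn_ge0; lra.
apply: le_trans (nrmD _ _) _.
have h3 : nrm (((1 + A) ^+ k - (1 + B) ^+ k) * (1 + A)) <=
   k%:R * N1 * (1 + c) ^+ k.+1 * nrm (A - B).
  rewrite mulrDr mulr1; apply: le_trans (nrmD _ _) _.
  apply: (@le_trans _ _ (nrm ((1 + A) ^+ k - (1 + B) ^+ k) * (1 + c))).
    rewrite mulrDr mulr1 lerD //; apply: le_trans (nrmM _ _) _.
    by rewrite ler_wpM2l ?nrm_ge0.
  apply: (le_trans (ler_wpM2r _ IH)); first lra.
  by rewrite exprSr le_eqVlt; apply/orP; left; apply/eqP; ring.
have h4 : nrm ((1 + B) ^+ k * (A - B)) <= N1 * (1 + c) ^+ k.+1 * nrm (A - B).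
  apply: le_trans (nrmM _ _) _; rewrite ler_wpM2r //.
  apply: le_trans (nrm_expr_1D _ hB) _; rewrite -/N1 ler_wpM2l // exprSr.
  by rewrite ler_peMr // lerDl.
apply: le_trans (lerD h3 h4) _; rewrite le_eqVlt; apply/orP; left; apply/eqP.
by rewrite -natr1; ring.
Qed.

End EntrywiseNorm.

Section MatrixExponential.
Variables (R : realType) (n : nat).
Local Notation C := (R[i]).
Local Notation Re := (@complex.Re R).
Implicit Types (M H X : 'M[C]_n) (u : 'rV[C]_n).

Definition eigv M (i : 'I_n) : R := Re (spectral_diag M 0 i).

Lemma spectralmx_unitary M : unitary (spectralmx M).
Proof.
by have /unitarymxP := spectral_unitarymx M; rewrite /unitary /hadj map_trmx.
Qed.

Lemma spectralE M : hadj M = M ->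
  unitary (spectralmx M) /\ M = spec (spectralmx M) (eigv M).
Proof.
move=> hM.
have hs : M \is hermsymmx.
  apply/is_hermitianmxP; rewrite expr0 scale1r.
  by rewrite -{1}hM /hadj map_trmx.
have hn := hermitian_normalmx hs.
have hr := hermitian_spectral_diag_real hs.
split; first exact: spectralmx_unitary.
have e : invmx (spectralmx M) = hadj (spectralmx M).
  by rewrite (invmx_unitary (spectral_unitarymx M)) /hadj map_trmx.
move/orthomx_spectralP: hn => {1}->; rewrite e.
congr (_ *m diag_mx _ *m _).
apply/rowP => i; rewrite mxE.
by move/mxOverP: hr => /(_ 0 i)/RRe_real.
Qed.

(* Junk value outside Hermitian matrices. *)
Definition mexp M : 'M[C]_n := spec (spectralmx M) (fun i => expR (eigv M i)).

(* The exponents are powers of two for [rtr_expr2_le], and even so that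
   [euler k M] is positive semidefinite for every Hermitian [M]. *)
Definition euler k M : 'M[C]_n := (1 + ((2 ^ k.+1)%:R^-1)%:C *: M) ^+ (2 ^ k.+1).

Lemma euler_spec k (U : 'M[C]_n) s : unitary U ->
  euler k (spec U s) = spec U (fun i => (1 + s i / (2 ^ k.+1)%:R) ^+ (2 ^ k.+1)).
Proof.
move=> hU; rewrite /euler specZ -[1]/(1%:M) -(spec1 hU) specD specX //.
by congr spec; apply/funext => i; rewrite mulrC.
Qed.

Lemma cvg_qf_euler M u : hadj M = M ->
  (fun k => qf u (euler k M)) @ \oo --> qf u (mexp M).
Proof.
move=> /spectralE [hU hM]; rewrite /mexp qf_spec.
have e k : qf u (euler k M) = \sum_j
    (1 + eigv M j / (2 ^ k.+1)%:R) ^+ (2 ^ k.+1) * nsq ((u *m hadj (spectralmx M)) 0 j).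
  by rewrite [in LHS]hM euler_spec // qf_spec.
under eq_fun do rewrite e.
apply: cvg_sumr => j; apply: cvgMr_tmp; exact: expR_cvg.
Qed.

Lemma cvg_rtr_euler_spec (U : 'M[C]_n) s : unitary U ->
  (fun k => rtr (euler k (spec U s))) @ \oo --> \sum_i expR (s i).
Proof.
move=> hU; under eq_fun do rewrite euler_spec // rtr_spec //.
by apply: cvg_sumr => j; exact: expR_cvg.
Qed.

Lemma cvg_rtr_euler M : hadj M = M ->
  (fun k => rtr (euler k M)) @ \oo --> rtr (mexp M).
Proof.
move=> /spectralE [hU hM]; rewrite /mexp rtr_spec //.
by rewrite [in X in X --> _]hM; exact: cvg_rtr_euler_spec.
Qed.

Lemma rtr_mexp_spec (U : 'M[C]_n) s : unitary U ->
  rtr (mexp (spec U s)) = \sum_i expR (s i).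
Proof.
move=> hU; have h1 := cvg_rtr_euler (hadj_spec U s).
have h2 := cvg_rtr_euler_spec (s := s) hU.
exact: (cvg_unique _ h1 h2).
Qed.

Lemma qf_euler_ge0 M u k : hadj M = M -> 0 <= qf u (euler k M).
Proof.
move=> /spectralE [hU ->]; rewrite euler_spec // qf_spec.
apply: sumr_ge0 => j _; rewrite mulr_ge0 ?nsq_ge0 //.
by rewrite expnS exprM exprn_ge0 // sqr_ge0.
Qed.

Lemma qf_mexp_ge0 M u : 0 <= qf u (mexp M).
Proof.
rewrite /mexp qf_spec; apply: sumr_ge0 => j _.
by rewrite mulr_ge0 ?nsq_ge0 ?expR_ge0.
Qed.

Lemma rtr_mexp_ge0 M : 0 <= rtr (mexp M).
Proof.
rewrite rtr_spec; last exact: spectralmx_unitary.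
by apply: sumr_ge0 => i _; exact: expR_ge0.
Qed.

Lemma rtr_mexp_mul H M : rtr (mexp H *m M) =
  \sum_i expR (eigv H i) * qf (row i (spectralmx H)) M.
Proof. exact: rtr_spec_mul. Qed.

Lemma cvg_rtr_euler_mul H X : hadj H = H -> hadj X = X ->
  (fun k => rtr (euler k H *m euler k X)) @ \oo --> rtr (mexp H *m mexp X).
Proof.
move=> /spectralE [hU hH] hX; rewrite rtr_mexp_mul.
have e k : rtr (euler k H *m euler k X) = \sum_i
    (1 + eigv H i / (2 ^ k.+1)%:R) ^+ (2 ^ k.+1) *
      qf (row i (spectralmx H)) (euler k X).
  by rewrite [in LHS]hH euler_spec // rtr_spec_mul.
under eq_fun do rewrite e.
apply: cvg_sumr => j; apply: cvgM; first exact: expR_cvg.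
exact: cvg_qf_euler.
Qed.

Lemma euler_mul_sub_cvg0 H X :
  (fun k => rtr (euler k (H + X)) -
    rtr (((1 + ((2 ^ k.+1)%:R^-1)%:C *: H) * (1 + ((2 ^ k.+1)%:R^-1)%:C *: X))
       ^+ (2 ^ k.+1))) @ \oo --> (0 : R).
Proof.
pose c := nrm (H + X) + nrm (H * X).
pose K := nrm (1 : 'M[C]_n) * expR c * nrm (H * X).
have c0 : 0 <= c by rewrite addr_ge0 ?nrm_ge0.
have bound k : `|rtr (euler k (H + X)) -
    rtr (((1 + ((2 ^ k.+1)%:R^-1)%:C *: H) * (1 + ((2 ^ k.+1)%:R^-1)%:C *: X))
       ^+ (2 ^ k.+1))| <= K * (2 ^ k.+1)%:R^-1.
  have : (0 < 2 ^ k.+1)%N by rewrite expn_gt0.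
  rewrite /euler; case: (2 ^ k.+1)%N => // N _ {k}.
  set e : R := N.+1%:R^-1.
  have e0 : 0 <= e by rewrite invr_ge0.
  have e1 : e <= 1 by rewrite invf_le1 ?ltr0n // ler1n.
  set A := e%:C *: (H + X); set B := A + (e ^+ 2)%:C *: (H * X).
  have -> : (1 + e%:C *: H) * (1 + e%:C *: X) = 1 + B.
    rewrite mulrDl mul1r mulrDr mulr1.
    rewrite -[_ * (e%:C *: X)]/(_ *m _) -scalemxAl -scalemxAr scalerA -rmorphM.
    by rewrite -expr2 /B /A scalerDr !addrA (addrAC 1).
  rewrite -rtrN -rtrD; apply: le_trans (rtr_le_nrm _) _.
  have hA : nrm A <= c * e.
    rewrite /A nrmZ ger0_norm // mulrC ler_wpM2r // /c.
    by rewrite lerDl nrm_ge0.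
  have hB : nrm B <= c * e.
    apply: le_trans (nrmD _ _) _; rewrite /c mulrDl.
    rewrite /A !nrmZ !ger0_norm ?sqr_ge0 // (mulrC e) lerD //.
    by rewrite mulrC ler_wpM2l ?nrm_ge0 // expr2 ler_piMl.
  apply: le_trans (nrm_expr_sub _ hA hB) _.
  have -> : nrm (A - B) = e ^+ 2 * nrm (H * X).
    rewrite /B opprD addrA subrr add0r -scaleNr -rmorphN.
    by rewrite nrmZ normrN ger0_norm ?sqr_ge0.
  have hc : (1 + c * e) ^+ N.+1 <= expR c.
    by apply: expR_approx_le; rewrite addr_ge0 // mulr_ge0.
  have -> : N.+1%:R * nrm (1 : 'M[C]_n) * (1 + c * e) ^+ N.+1 *
       (e ^+ 2 * nrm (H * X)) =
    nrm (1 : 'M[C]_n) * (1 + c * e) ^+ N.+1 * nrm (H * X) * e.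
    have he : N.+1%:R * e = 1 by rewrite mulfV.
    set a := nrm 1; set b := (1 + c * e) ^+ _; set d := nrm _.
    transitivity (N.+1%:R * e * (a * b * d * e)); first by ring.
    by rewrite he mul1r.
  rewrite ler_wpM2r // ler_wpM2r ?nrm_ge0 // ler_wpM2l ?nrm_ge0 //.
apply/norm_cvg0P.
apply: (@squeeze_cvgr _ _ _ _ (cst 0) (fun k => K * (2 ^ k.+1)%:R^-1)).
- by near=> k; rewrite normr_ge0 bound.
- exact: cvg_cst.
- rewrite -[X in _ --> X](mulr0 K); apply: cvgMl_tmp; exact: invn_cvg0.
Unshelve. all: by end_near.
Qed.

Lemma hadj_1DZ M a : hadj M = M -> hadj (1 + a%:C *: M) = 1 + a%:C *: M.
Proof.
by move=> hM; rewrite hadjD hadjZ hM; congr (_ + _); exact: hadj1.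
Qed.

Theorem golden_thompson H X : hadj H = H -> hadj X = X ->
  rtr (mexp (H + X)) <= rtr (mexp H *m mexp X).
Proof.
move=> hH hX.
have hHX : hadj (H + X) = H + X by rewrite hadjD hH hX.
have h1 : (fun k => rtr (((1 + ((2 ^ k.+1)%:R^-1)%:C *: H) *
    (1 + ((2 ^ k.+1)%:R^-1)%:C *: X)) ^+ (2 ^ k.+1))) @ \oo -->
    rtr (mexp (H + X)).
  rewrite -[X in _ --> X]subr0.
  under eq_fun => k do rewrite -[rtr _](subKr (rtr (euler k (H + X)))).
  by apply: cvgB; [exact: cvg_rtr_euler | exact: euler_mul_sub_cvg0].
have h2 := cvg_rtr_euler_mul hH hX.
rewrite -(cvg_lim _ h1) // -(cvg_lim _ h2) //.
apply: ler_lim; [by apply/cvg_ex; eexists; exact: h1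
  | by apply/cvg_ex; eexists; exact: h2 | ].
apply: nearW => k /=.
apply: (proj2 (rtr_expr2_le _ _ _)).
all: exact: hadj_1DZ.
Qed.

Lemma qf_row_spec (U : 'M[C]_n) s i : unitary U -> qf (row i U) (spec U s) = s i.
Proof.
move=> hU; rewrite qf_spec (bigD1 i) //= -row_mul hU big1 ?addr0.
  by rewrite !mxE eqxx /nsq /= expr1n expr0n addr0 mulr1.
by move=> j hj; rewrite !mxE eq_sym (negbTE hj) /nsq /= !expr0n addr0 mulr0.
Qed.

(* Klein's inequality: convexity of [tr exp]. *)
Theorem rtr_mexp_tangent H B : hadj H = H -> hadj B = B ->
  rtr (mexp H) + rtr (mexp H *m B) <= rtr (mexp (H + B)).
Proof.
move=> hH hB; have hHB : hadj (H + B) = H + B by rewrite hadjD hH hB.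
have [hU eH] := spectralE hH; have [hV eK] := spectralE hHB.
set U := spectralmx H in hU eH; set V := spectralmx (H + B) in hV eK.
set W := U *m hadj V.
have hW : unitary W by apply: unitaryM => //; exact: unitary_adj.
rewrite rtr_mexp_mul /mexp !rtr_spec // -big_split /=.
have -> : \sum_i expR (eigv (H + B) i) =
    \sum_i \sum_j expR (eigv (H + B) j) * nsq (W i j).
  rewrite exchange_big /=; apply: eq_bigr => j _.
  by rewrite -mulr_sumr sum_nsq_unitaryC // mulr1.
apply: ler_sum => i _.
have hq : qf (row i U) B = \sum_j (eigv (H + B) j - eigv H i) * nsq (W i j).
  have := qfD (row i U) H B.
  rewrite {2}eH qf_row_spec // {1}eK qf_spec -row_mul -/W => e.
  under eq_bigr do rewrite mulrBl.
  rewrite sumrB -mulr_sumr sum_nsq_unitary // mulr1.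
  apply/eqP; rewrite eq_sym subr_eq (addrC (qf _ _)) -e; apply/eqP.
  by apply: eq_bigr => j _; rewrite [row _ _ _ _]mxE.
have {1}-> : expR (eigv H i) = \sum_j expR (eigv H i) * nsq (W i j).
  by rewrite -mulr_sumr sum_nsq_unitary // mulr1.
rewrite hq mulr_sumr -big_split /=; apply: ler_sum => j _.
rewrite mulrA -mulrDl ler_wpM2r ?nsq_ge0 //.
have := expR_ge1Dx (eigv (H + B) j - eigv H i).
move=> /(ler_wpM2l (expR_ge0 (eigv H i))).
by rewrite -expRD mulrDr mulr1 (addrC (eigv H i) (_ - _)) subrK.
Qed.

End MatrixExponential.

(** * Largest eigenvalue *)

Section LargestEigenvalue.
Variables (R : realType) (n : nat).
Hypothesis n0 : (0 < n)%N.
Local Notation C := (R[i]).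
Implicit Types (M : 'M[C]_n).

Lemma eigenvalue_eigv M i : hadj M = M -> eigenvalue M (eigv M i)%:C.
Proof.
move=> /spectralE [hU hM]; apply/eigenvalueP; exists (row i (spectralmx M)).
  rewrite [in X in _ *m X]hM /spec -row_mul !mulmxA hU mul1mx.
  apply/rowP => j; rewrite mul_diag_mx !mxE; congr (_%:C * _).
apply/eqP => h; have := congr1 (fun v => (v *m hadj (spectralmx M)) 0 i) h.
rewrite -row_mul hU mul0mx !mxE eqxx => /eqP; by rewrite oner_eq0.
Qed.

Lemma eigenvalue_is_eigv M (x : R) : hadj M = M -> eigenvalue M x%:C ->
  exists i, x = eigv M i.
Proof.
move=> /spectralE [hU hM] /eigenvalueP [v hv v0].
set U := spectralmx M in hU hM.
pose y := v *m hadj U.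
have hVU : hadj U *m U = 1%:M by exact: mulmx1C.
have hvy : v = y *m U by rewrite /y -mulmxA hVU mulmx1.
have y0 : y != 0 by apply: contraNneq v0 => y0; rewrite hvy y0 mul0mx.
have [i yi] : exists i, y 0 i != 0.
  apply/existsP; apply: contraNT y0; rewrite negb_exists => /forallP h.
  by apply/eqP/rowP => i; rewrite [RHS]mxE; apply/eqP; have := h i; rewrite negbK.
exists i; have : y *m diag_mx (\row_i (eigv M i)%:C) = x%:C *: y.
  rewrite /y scalemxAl -hv [in RHS]hM /spec !mulmxA -(mulmxA _ U) hU mulmx1.
  by [].
clearbody y; move=> /rowP /(_ i); rewrite mul_mx_diag !mxE mulrC => /(mulIf yi).
by move=> /complexI.
Qed.

Lemma has_sup_eigenvalue M : hadj M = M ->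
  has_sup [set x : R | eigenvalue M x%:C].
Proof.
move=> hM; split.
  by exists (eigv M (Ordinal n0)); exact: eigenvalue_eigv.
exists (\sum_i `|eigv M i|) => x /= /(eigenvalue_is_eigv hM) [i ->].
rewrite (bigD1 i) //=; apply: le_trans (ler_norm _) _.
by rewrite lerDl; apply: sumr_ge0.
Qed.

Lemma eigv_le_lambda_max M i : hadj M = M -> eigv M i <= lambda_max M.
Proof.
move=> hM; apply: ub_le_sup; last exact: eigenvalue_eigv.
by case: (has_sup_eigenvalue hM).
Qed.

Lemma lambda_max_attained M : hadj M = M -> exists i, lambda_max M = eigv M i.
Proof.
move=> hM; have [i _ hi] :=
  @Order.TotalTheory.arg_maxP _ _ _ (Ordinal n0) xpredT (eigv M) isT.
exists i; apply/le_anti/andP; split; last exact: eigv_le_lambda_max.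
apply: sup_le_ub; first by case: (has_sup_eigenvalue hM).
by move=> x /= /(eigenvalue_is_eigv hM) [j ->]; exact: hi.
Qed.

Lemma rtr_mexpZ M a : hadj M = M ->
  rtr (mexp (a%:C *: M)) = \sum_i expR (a * eigv M i).
Proof.
by move=> /spectralE [hU hM]; rewrite [in LHS]hM specZ rtr_mexp_spec.
Qed.

Lemma expR_lambda_max_le M a : hadj M = M ->
  expR (a * lambda_max M) <= rtr (mexp (a%:C *: M)).
Proof.
move=> hM; have [i ->] := lambda_max_attained hM.
rewrite rtr_mexpZ // (bigD1 i) //= lerDl.
by apply: sumr_ge0 => j _; exact: expR_ge0.
Qed.

Lemma rtr_mexp_le M a : hadj M = M -> 0 <= a ->
  rtr (mexp (a%:C *: M)) <= n%:R * expR (a * lambda_max M).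
Proof.
move=> hM a0; rewrite rtr_mexpZ //.
rewrite -[X in X%:R * _]card_ord -sumr_const mulr_suml; apply: ler_sum => i _.
by rewrite mul1r ler_expR ler_wpM2l // eigv_le_lambda_max.
Qed.

(* Writes a tail event of [lambda_max] as a countable intersection of events
   on the measurable functions [tr exp (k S)]. *)
Lemma lambda_max_geP M (t : R) : hadj M = M ->
  (t <= lambda_max M) <->
  (forall k : nat, expR (k%:R * t) <= rtr (mexp ((k%:R)%:C *: M))).
Proof.
move=> hM; split => [h k|h].
  apply: le_trans (expR_lambda_max_le _ hM).
  by rewrite ler_expR ler_wpM2l.
rewrite leNgt; apply/negP => lt.
have d0 : 0 < t - lambda_max M by rewrite subr_gt0.
pose k := (Num.truncn (n%:R / (t - lambda_max M))).+1.
have hk : n%:R < k%:R * (t - lambda_max M).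
  by rewrite -ltr_pdivrMr // /k truncnS_gt.
have := h k; apply/negP; rewrite -ltNge.
apply: le_lt_trans (rtr_mexp_le hM _) _ => //.
have -> : k%:R * t = k%:R * lambda_max M + k%:R * (t - lambda_max M).
  by rewrite -mulrDr addrC subrK.
rewrite expRD mulrC ltr_pM2l ?expR_gt0 //.
by apply: lt_le_trans hk _; apply: le_trans (expR_ge1Dx _); rewrite lerDr.
Qed.

Lemma lambda_max_le_norm M : hadj M = M ->
  lambda_max M <= Num.sqrt (lambda_max (hadj M *m M)).
Proof.
move=> hM; have [i ->] := lambda_max_attained hM.
have hMM : hadj (hadj M *m M) = hadj M *m M by rewrite hadj_mul hadjK.
apply: le_trans (ler_norm _) _; rewrite -sqrtr_sqr; apply: ler_wsqrtr.
apply: ub_le_sup; first by case: (has_sup_eigenvalue hMM).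
have /eigenvalueP [v hv v0] := eigenvalue_eigv i hM.
apply/eigenvalueP; exists v => //.
by rewrite hM mulmxA hv -scalemxAl hv scalerA expr2 rmorphM.
Qed.

End LargestEigenvalue.

(** * Block circulant matrices *)

Section BlockCirculant.
Variables (R : realType) (m p' : nat).
Local Notation p := (p'.+1).
Local Notation C := (R[i]).
Implicit Types X Y : tensor R m p.

Lemma inner_subproof (i : 'I_(m * p)) : (i %% m < m)%N.
Proof. by rewrite ltn_mod; case: m i => [[]|]. Qed.

Definition inner (i : 'I_(m * p)) : 'I_m := Ordinal (inner_subproof i).

Lemma outer_subproof (i : 'I_(m * p)) : (i %/ m < p)%N.
Proof. by rewrite ltn_divLR ?(mulnC p) ?ltn_ord //; case: m i => [[]|]. Qed.

Definition outer (i : 'I_(m * p)) : 'I_p := Ordinal (outer_subproof i).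

Lemma flat_subproof (r : 'I_p) (a : 'I_m) : (r * m + a < m * p)%N.
Proof.
apply: (@leq_trans (r.+1 * m)); first by rewrite mulSn addnC ltn_add2r.
by rewrite mulnC leq_mul2l ltn_ord orbT.
Qed.

Definition flat (u : 'I_p * 'I_m) : 'I_(m * p) :=
  Ordinal (flat_subproof u.1 u.2).

Lemma outer_flat u : outer (flat u) = u.1.
Proof.
case: u => r a; apply: val_inj => /=.
have m0 : (0 < m)%N by apply: leq_ltn_trans (ltn_ord a).
by rewrite divnMDl // divn_small ?addn0.
Qed.

Lemma inner_flat u : inner (flat u) = u.2.
Proof. by case: u => r a; apply: val_inj; rewrite /= modnMDl modn_small. Qed.

Lemma flatK i : flat (outer i, inner i) = i.
Proof. by apply: val_inj; rewrite /= -divn_eq. Qed.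

Lemma sum_flat (F : 'I_(m * p) -> C) :
  \sum_i F i = \sum_r \sum_a F (flat (r, a)).
Proof.
rewrite pair_bigA /=; rewrite (reindex flat) /=.
  by apply: eq_bigr => -[].
exists (fun i => (outer i, inner i)) => [u _|i _]; last exact: flatK.
by rewrite outer_flat inner_flat; case: u.
Qed.

Lemma tentE X k a b (k' : 'I_p) (a' b' : 'I_m) :
  k = k' :> nat -> a = a' :> nat -> b = b' :> nat ->
  tent X k a b = X k' a' b'.
Proof. by move=> -> -> ->; rewrite /tent !valK. Qed.

Lemma bcircE X i j :
  bcirc X i j = X (outer i - outer j) (inner i) (inner j).
Proof.
rewrite mxE; apply: tentE => //=.
by rewrite modnDmr addnBA // ltnW // outer_subproof.
Qed.

Lemma tprodE X Y k : tprod X Y k = \sum_j X (k - j) *m Y j.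
Proof.
rewrite ffunE; apply: eq_bigr => j _; congr (_ *m _).
apply/matrixP => a b; rewrite mxE; apply: tentE => //=.
by rewrite modnDmr addnBA // ltnW.
Qed.

Lemma tconjTE X k : tconjT X k = ctr (X (- k)).
Proof.
rewrite ffunE; congr ctr; apply/matrixP => a b; rewrite mxE.
exact: tentE.
Qed.

Lemma bcirc_tprod X Y : bcirc (tprod X Y) = bcirc X *m bcirc Y.
Proof.
apply/matrixP => i j; rewrite bcircE tprodE summxE mxE sum_flat.
rewrite (reindex_inj (addIr (- outer j))) /=.
apply: eq_bigr => r _; rewrite mxE; apply: eq_bigr => a _.
by rewrite !bcircE outer_flat inner_flat /= opprB addrA subrK.
Qed.

Lemma bcirc_tid : bcirc (tid R m p) = 1%:M.
Proof.
apply/matrixP => i j; rewrite bcircE ffunE.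
have -> : ((outer i - outer j : 'I_p) == 0 :> nat) = (outer i == outer j).
  by rewrite -subr_eq0.
case: eqP => [e|ne]; rewrite !mxE; last first.
  by case: eqP => // e; case: ne; rewrite e.
congr (_%:R); congr nat_of_bool; apply/eqP/eqP => [e'|-> //].
by rewrite -(flatK i) -(flatK j) e e'.
Qed.

Lemma bcirc_tpow X k : bcirc (tpow X k) = bcirc X ^+ k.
Proof.
elim: k => [|k IH]; first by rewrite expr0; exact: bcirc_tid.
by rewrite exprS /= bcirc_tprod IH.
Qed.

Lemma bcircD X Y : bcirc (X + Y) = bcirc X + bcirc Y.
Proof. by apply/matrixP => i j; rewrite [RHS]mxE !bcircE ffunE mxE. Qed.

Lemma bcircB X Y : bcirc (X - Y) = bcirc X - bcirc Y.
Proof.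
by apply/matrixP => i j; rewrite [RHS]mxE [(- bcirc Y) i j]mxE !bcircE !ffunE 2!mxE.
Qed.

Lemma bcircZ a X : bcirc (a *: X) = a *: bcirc X.
Proof. by apply/matrixP => i j; rewrite [RHS]mxE !bcircE ffunE mxE. Qed.

Lemma bcirc0 : bcirc (0 : tensor R m p) = 0.
Proof. by apply/matrixP => i j; rewrite bcircE ffunE !mxE. Qed.

Lemma bcirc_sum I (r : seq I) (Q : pred I) (F : I -> tensor R m p) :
  bcirc (\sum_(i <- r | Q i) F i) = \sum_(i <- r | Q i) bcirc (F i).
Proof. exact: (big_morph _ bcircD bcirc0). Qed.

Lemma bcirc_hermitian X : thermitian X -> hadj (bcirc X) = bcirc X.
Proof.
move=> hX; apply/matrixP => i j; rewrite [RHS]bcircE -[in RHS]hX tconjTE.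
by rewrite opprB 2![LHS]mxE bcircE !mxE.
Qed.

End BlockCirculant.

(** * Random matrices *)

Section MeasurableMatrices.
Context d (S : measurableType d) (R : realType) (n : nat).
Local Notation C := (R[i]).
Local Notation Re := (@complex.Re R).
Local Notation Im := (@complex.Im R).
Implicit Types M N : S -> 'M[C]_n.

Definition cmeasurable (f : S -> C) :=
  measurable_fun setT (fun w => Re (f w)) /\
  measurable_fun setT (fun w => Im (f w)).

Definition mx_measurable M := forall i j, cmeasurable (fun w => M w i j).

Lemma cmeasurable_cst (c : C) : cmeasurable (fun=> c).
Proof. by split; exact: measurable_cst. Qed.

Lemma cmeasurableD f g : cmeasurable f -> cmeasurable g ->
  cmeasurable (fun w => f w + g w).
Proof.
move=> [f1 f2] [g1 g2]; split.
  by under eq_fun do rewrite Re_add; exact: measurable_funD.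
by under eq_fun do rewrite Im_add; exact: measurable_funD.
Qed.

Lemma cmeasurableM f g : cmeasurable f -> cmeasurable g ->
  cmeasurable (fun w => f w * g w).
Proof.
move=> [f1 f2] [g1 g2]; split.
  by under eq_fun do rewrite Re_mul; apply: measurable_funB; exact: measurable_funM.
by under eq_fun do rewrite Im_mul; apply: measurable_funD; exact: measurable_funM.
Qed.

Lemma cmeasurable_sum I (r : seq I) (Q : pred I) (f : I -> S -> C) :
  (forall i, Q i -> cmeasurable (f i)) ->
  cmeasurable (fun w => \sum_(i <- r | Q i) f i w).
Proof.
move=> hf; elim: r => [|a r IH].
  by under eq_fun do rewrite big_nil; exact: cmeasurable_cst.
under eq_fun do rewrite big_cons.
case: (boolP (Q a)) => [/hf ha|_ //].
exact: cmeasurableD.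
Qed.

Lemma mx_measurable_cst (M : 'M[C]_n) : mx_measurable (fun=> M).
Proof. by move=> i j; exact: cmeasurable_cst. Qed.

Lemma mx_measurableD M N : mx_measurable M -> mx_measurable N ->
  mx_measurable (fun w => M w + N w).
Proof.
by move=> hM hN i j; under eq_fun do rewrite mxE; exact: cmeasurableD.
Qed.

Lemma mx_measurable_sum I (r : seq I) (Q : pred I) (M : I -> S -> 'M[C]_n) :
  (forall i, Q i -> mx_measurable (M i)) ->
  mx_measurable (fun w => \sum_(i <- r | Q i) M i w).
Proof.
move=> h i j; under eq_fun do rewrite summxE.
by apply: cmeasurable_sum => k Qk; exact: h.
Qed.

Lemma mx_measurableZ (a : C) M : mx_measurable M ->
  mx_measurable (fun w => a *: M w).
Proof.
move=> hM i j; under eq_fun do rewrite mxE.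
by apply: cmeasurableM => //; exact: cmeasurable_cst.
Qed.

Lemma mx_measurableM M N : mx_measurable M -> mx_measurable N ->
  mx_measurable (fun w => M w * N w).
Proof.
move=> hM hN i j; under eq_fun do rewrite mxE.
by apply: cmeasurable_sum => k _; exact: cmeasurableM.
Qed.

Lemma mx_measurableX M k : mx_measurable M -> mx_measurable (fun w => M w ^+ k).
Proof.
move=> hM; elim: k => [|k IH].
  by under eq_fun do rewrite expr0; exact: mx_measurable_cst.
by under eq_fun do rewrite exprS; exact: mx_measurableM.
Qed.

Lemma mx_measurable_euler M k : mx_measurable M ->
  mx_measurable (fun w => euler k (M w)).
Proof.
move=> hM; apply: mx_measurableX; apply: mx_measurableD.
  exact: mx_measurable_cst.
exact: mx_measurableZ.
Qed.

Lemma measurable_rtr M : mx_measurable M ->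
  measurable_fun setT (fun w => rtr (M w)).
Proof.
move=> hM; suff : cmeasurable (fun w => \tr (M w)) by case.
by apply: cmeasurable_sum => i _; exact: hM.
Qed.

Lemma measurable_qf M u : mx_measurable M ->
  measurable_fun setT (fun w => qf u (M w)).
Proof.
move=> hM; suff : cmeasurable (fun w => (u *m M w *m hadj u) 0 0) by case.
under eq_fun do rewrite mxE; apply: cmeasurable_sum => i _.
apply: cmeasurableM; last exact: cmeasurable_cst.
under eq_fun do rewrite mxE; apply: cmeasurable_sum => j _.
apply: cmeasurableM; [exact: cmeasurable_cst | exact: hM].
Qed.

Lemma measurable_rtr_mexp M : (forall w, hadj (M w) = M w) ->
  mx_measurable M -> measurable_fun setT (fun w => rtr (mexp (M w))).
Proof.
move=> hM mM.
apply: (@measurable_fun_cvg _ _ _ _ (fun k w => rtr (euler k (M w)))).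
  by move=> k; exact/measurable_rtr/mx_measurable_euler.
by move=> w _; exact: cvg_rtr_euler.
Qed.

Lemma measurable_qf_mexp M u : (forall w, hadj (M w) = M w) ->
  mx_measurable M -> measurable_fun setT (fun w => qf u (mexp (M w))).
Proof.
move=> hM mM.
apply: (@measurable_fun_cvg _ _ _ _ (fun k w => qf u (euler k (M w)))).
  by move=> k; exact/measurable_qf/mx_measurable_euler.
by move=> w _; exact: cvg_qf_euler.
Qed.

End MeasurableMatrices.

(** * Exponential moment of one summand *)

Section BernsteinMoments.
Variable R : realType.

Lemma ffact_le_expn N k : (N ^_ k <= N ^ k)%N.
Proof.
elim: k => [|k IH] //; rewrite ffactnSr expnSr.
by apply: leq_mul => //; exact: leq_subr.
Qed.

Lemma geometric_le (x : R) k : 0 <= x -> x < 1 -> \sum_(i < k) x ^+ i <= (1 - x)^-1.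
Proof.
move=> x0 x1; have d0 : 0 < 1 - x by rewrite subr_gt0.
rewrite -div1r ler_pdivlMr // mulrC.
have -> : (1 - x) * \sum_(i < k) x ^+ i = 1 - x ^+ k.
  elim: k => [|k IH]; first by rewrite big_ord0 mulr0 expr0 subrr.
  by rewrite big_ord_recr /= mulrDr IH exprS; ring.
by rewrite gerBl exprn_ge0.
Qed.

Lemma bernstein_moment_sum (N : nat) (t T : R) : 0 <= t -> 0 <= T -> t * T < 1 ->
  \sum_(k < N.+1 | (2 <= k)%N)
    ('C(N, k)%:R * (t / N%:R) ^+ k) * ((k`!)%:R * T ^+ (k - 2) / 2) <=
  t ^+ 2 / (2 * (1 - t * T)).
Proof.
move=> t0 T0 tT.
have -> : t ^+ 2 / (2 * (1 - t * T)) = (t ^+ 2 / 2) * (1 - t * T)^-1.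
  by rewrite invfM mulrA.
have h0 : 0 <= t ^+ 2 / 2 by rewrite divr_ge0 ?sqr_ge0.
apply: le_trans (ler_wpM2l h0 (@geometric_le _ N.-1 (mulr_ge0 t0 T0) tT)).
have term (k : nat) : (2 <= k)%N ->
   ('C(N, k)%:R * (t / N%:R) ^+ k) * ((k`!)%:R * T ^+ (k - 2) / 2) <=
   t ^+ 2 / 2 * (t * T) ^+ (k - 2).
  move=> k2; case: N => [|N].
    rewrite bin_small ?(leq_trans _ k2) // !mul0r mulr_ge0 // exprn_ge0 //.
    exact: mulr_ge0.
  have hN : 0 < N.+1%:R :> R by rewrite ltr0n.
  have h1 : 'C(N.+1, k)%:R * (k`!)%:R / N.+1%:R ^+ k <= 1 :> R.
    rewrite ler_pdivrMr ?exprn_gt0 // mul1r -natrM bin_ffact -natrX ler_nat.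
    exact: ffact_le_expn.
  have -> : 'C(N.+1, k)%:R * (t / N.+1%:R) ^+ k * ((k`!)%:R * T ^+ (k - 2) / 2) =
     ('C(N.+1, k)%:R * (k`!)%:R / N.+1%:R ^+ k) *
     (t ^+ 2 / 2 * (t * T) ^+ (k - 2)).
    have -> : (t / N.+1%:R) ^+ k = t ^+ 2 * t ^+ (k - 2) / N.+1%:R ^+ k.
      by rewrite expr_div_n -exprD subnKC.
    rewrite exprMn.
    set a := 'C(_, _)%:R; set b := (k`!)%:R; set c := _ ^+ k; field.
    by rewrite lt0r_neq0 // exprn_gt0.
  rewrite ler_piMl // mulr_ge0 // exprn_ge0 //; exact: mulr_ge0.
apply: (le_trans (ler_sum _ (fun (k : 'I_N.+1) hk => term k hk))).
rewrite -mulr_sumr ler_wpM2l // le_eqVlt; apply/orP; left; apply/eqP.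
case: N {term} => [|N]; rewrite big_mkcond big_ord_recl /= add0r.
  by rewrite !big_ord0.
rewrite big_ord_recl /= add0r; apply: eq_bigr => i _.
by rewrite /bump /= !add1n subSS subSS subn0.
Qed.

End BernsteinMoments.

Section ScalarExpectation.
Context d (Omega : measurableType d) (R : realType) (P : probability Omega R).

Definition has_expectation (f : Omega -> R) (v : R) :=
  P.-integrable setT (fun w => (f w)%:E) /\ (\int[P]_w (f w)%:E = v%:E)%E.

Lemma has_expectation_integrable f : P.-integrable setT (fun w => (f w)%:E) ->
  has_expectation f (fine (\int[P]_w (f w)%:E)).
Proof.
move=> hf; split => //; rewrite fineK //; exact: integrable_fin_num.
Qed.

Lemma has_expectation_cst c : has_expectation (fun=> c) c.
Proof.
split; first exact: finite_measure_integrable_cst.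
by rewrite integral_cst //= probability_setT mule1.
Qed.

Lemma has_expectationZ a f v : has_expectation f v ->
  has_expectation (fun w => a * f w) (a * v).
Proof.
move=> [h1 h2]; split.
  by under eq_fun do rewrite EFinM; exact: integrableZl.
by under eq_integral do rewrite EFinM; rewrite integralZl // h2.
Qed.

Lemma has_expectationD f g v1 v2 : has_expectation f v1 -> has_expectation g v2 ->
  has_expectation (fun w => f w + g w) (v1 + v2).
Proof.
move=> [h1 h2] [h3 h4]; split.
  by under eq_fun do rewrite EFinD; exact: integrableD.
by under eq_integral do rewrite EFinD; rewrite integralD // h2 h4.
Qed.

Lemma has_expectation_sum I (r : seq I) (f : I -> Omega -> R) v :
  (forall i, has_expectation (f i) (v i)) ->
  has_expectation (fun w => \sum_(i <- r) f i w) (\sum_(i <- r) v i).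
Proof.
move=> h; elim: r => [|a r IH].
  by under eq_fun do rewrite big_nil; rewrite big_nil; exact: has_expectation_cst.
by under eq_fun do rewrite big_cons; rewrite big_cons; exact: has_expectationD.
Qed.

End ScalarExpectation.

Lemma qf_euler_expand (R : realType) n (M : 'M[R[i]]_n) u k t : hadj M = M ->
  qf u (euler k (t%:C *: M)) = \sum_(j < (2 ^ k.+1).+1)
    ('C(2 ^ k.+1, j)%:R * (t / (2 ^ k.+1)%:R) ^+ j) * qf u (M ^+ j).
Proof.
move=> /spectralE [hU hM]; set s := eigv M in hM; set U := spectralmx M in hU hM.
have e j : qf u (M ^+ j) = \sum_l s l ^+ j * nsq ((u *m hadj U) 0 l).
  by rewrite hM specX // qf_spec.
under eq_bigr do rewrite e mulr_sumr.
rewrite [in LHS]hM specZ euler_spec // qf_spec exchange_big /=.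
apply: eq_bigr => l _; set N := (2 ^ k.+1)%N; clearbody N.
rewrite [1 + _]addrC exprD1n mulr_suml; apply: eq_bigr => j _.
rewrite mulrA; congr (_ * _).
rewrite -mulr_natl -mulrA -exprMn; congr (_ * _ ^+ _).
by rewrite mulrAC.
Qed.

Section OneSummand.
Context d (Omega : measurableType d) (R : realType) (P : probability Omega R).
Variables (n : nat) (M : Omega -> 'M[R[i]]_n) (B : 'M[R[i]]_n) (t T : R).
Hypotheses (hM : forall w, hadj (M w) = M w) (mM : mx_measurable M).
Hypotheses (hB : hadj B = B) (B0 : forall u, 0 <= qf u B).
Hypotheses (t0 : 0 <= t) (T0 : 0 <= T) (tT : t * T < 1).
Hypothesis M1 : forall u, has_expectation P (fun w => qf u (M w)) 0.
Hypothesis Mk : forall k u, (2 <= k)%N -> exists2 v,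
  has_expectation P (fun w => qf u (M w ^+ k)) v &
  v <= (k`!)%:R * T ^+ (k - 2) / 2 * qf u B.

Local Notation g := (t ^+ 2 / (2 * (1 - t * T))).

Let htM w : hadj (t%:C *: M w) = t%:C *: M w.
Proof. by rewrite hadjZ hM. Qed.

Let mtM : mx_measurable (fun w => t%:C *: M w).
Proof. exact: mx_measurableZ. Qed.

Lemma integral_qf_euler_le u k :
  (\int[P]_w (qf u (euler k (t%:C *: M w)))%:E <= (qf u 1%:M + g * qf u B)%:E)%E.
Proof.
set N := (2 ^ k.+1)%N.
have /choice [v hv] : forall j : 'I_N.+1, exists v,
    has_expectation P (fun w => qf u (M w ^+ j)) v /\
    v <= (if j == 0 :> nat then qf u 1%:M
          else if (2 <= j)%N then (j`!)%:R * T ^+ (j - 2) / 2 * qf u B else 0).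
  case=> -[|[|j]] hj /=.
  - exists (qf u 1%:M); split => //; under eq_fun do rewrite expr0.
    exact: has_expectation_cst.
  - by exists 0; split => //; under eq_fun do rewrite expr1.
  - by have [v h1 h2] := Mk u (isT : (2 <= j.+2)%N); exists v.
have [_ hE] : has_expectation P (fun w => qf u (euler k (t%:C *: M w)))
    (\sum_(j < N.+1) ('C(N, j)%:R * (t / N%:R) ^+ j) * v j).
  under eq_fun do rewrite qf_euler_expand //.
  apply: has_expectation_sum => j; apply: has_expectationZ.
  exact: (hv j).1.
rewrite hE lee_fin.
have c0 j : 0 <= 'C(N, j)%:R * (t / N%:R) ^+ j.
  by rewrite mulr_ge0 // exprn_ge0 // divr_ge0.
apply: (@le_trans _ _ (\sum_(j < N.+1) ('C(N, j)%:R * (t / N%:R) ^+ j) *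
    (if j == 0 :> nat then qf u 1%:M
     else if (2 <= j)%N then (j`!)%:R * T ^+ (j - 2) / 2 * qf u B else 0))).
  by apply: ler_sum => j _; rewrite ler_wpM2l //; exact: (hv j).2.
apply: (@le_trans _ _ (qf u 1%:M + (\sum_(k < N.+1 | (2 <= k)%N)
    ('C(N, k)%:R * (t / N%:R) ^+ k) * ((k`!)%:R * T ^+ (k - 2) / 2)) * qf u B)).
  rewrite big_ord_recl /= bin0 expr0 !mul1r lerD2l mulr_suml [leRHS]big_mkcond /=.
  rewrite [leRHS]big_ord_recl /= add0r; apply: ler_sum => j _.
  by case: ifP => _; rewrite ?mulr0 // mulrA.
by rewrite lerD2l ler_wpM2r // bernstein_moment_sum.
Qed.

(* Fatou suffices because the approximations [(1 + t x / N) ^+ N] of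
   [expR (t x)] with [N] even are nonnegative. *)
Lemma integral_qf_mexp_le u :
  (\int[P]_w (qf u (mexp (t%:C *: M w)))%:E <= (qf u 1%:M + g * qf u B)%:E)%E.
Proof.
have := @fatou _ _ _ P setT measurableT
  (fun k w => (qf u (euler k (t%:C *: M w)))%:E).
have -> : (fun w => limn_einf ((fun k w => (qf u (euler k (t%:C *: M w)))%:E) ^~ w)) =
    (fun w => (qf u (mexp (t%:C *: M w)))%:E).
  apply/funext => w; apply: (cvg_limn_einf_sup _).1.
  by apply: cvg_EFin; [exact: nearW | exact: cvg_qf_euler].
move=> fatou; apply: (le_trans (fatou _ _)).
- by move=> k; apply/measurable_EFinP/measurable_qf/mx_measurable_euler.
- by move=> k w _; rewrite lee_fin qf_euler_ge0.
rewrite limn_einf_lim; apply: lime_le; first exact: is_cvg_einfs.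
apply: nearW => k; apply: le_trans (integral_qf_euler_le u k).
by apply: ereal_inf_lbound; exists k => /=.
Qed.

(* Golden-Thompson, then Klein's inequality in the direction [g *: B]. *)
Theorem integral_rtr_mexp_le (H : 'M[R[i]]_n) : hadj H = H ->
  (\int[P]_w (rtr (mexp (H + t%:C *: M w)))%:E <=
   (rtr (mexp (H + g%:C *: B)))%:E)%E.
Proof.
move=> hH.
have hgB : hadj (g%:C *: B) = g%:C *: B by rewrite hadjZ hB.
have mH : measurable_fun setT (fun w => rtr (mexp (H + t%:C *: M w))).
  apply: measurable_rtr_mexp => [w|]; first by rewrite hadjD hH htM.
  by apply: mx_measurableD => //; exact: mx_measurable_cst.
have mq u : measurable_fun setT (fun w => qf u (mexp (t%:C *: M w))).
  exact: measurable_qf_mexp.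
apply: (@le_trans _ _ (\int[P]_w (rtr (mexp H *m mexp (t%:C *: M w)))%:E)%E).
  apply: ge0_le_integral => //.
  - by move=> w _; rewrite lee_fin rtr_mexp_ge0.
  - exact/measurable_EFinP.
  - apply/measurable_EFinP; under eq_fun do rewrite rtr_mexp_mul.
    by apply: measurable_sum => i; apply: measurable_funM => //; exact: measurable_cst.
  - by move=> w _; rewrite lee_fin golden_thompson.
under eq_integral => w _.
  rewrite rtr_mexp_mul -sumEFin.
  under eq_bigr do rewrite EFinM.
  over.
rewrite ge0_integral_sum //; last 2 first.
- by move=> i; apply: emeasurable_funM; [exact: measurable_cst | exact/measurable_EFinP].
- by move=> i w _; rewrite -EFinM lee_fin mulr_ge0 ?expR_ge0 // qf_mexp_ge0.
apply: (@le_trans _ _ (rtr (mexp H) + rtr (mexp H *m (g%:C *: B)))%:E); last first.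
  by rewrite lee_fin rtr_mexp_tangent.
rewrite -[X in rtr X + _]mulmx1 !rtr_mexp_mul -big_split /= -sumEFin.
apply: lee_sum => i _.
rewrite ge0_integralZl //; last 2 first.
- exact/measurable_EFinP.
- by move=> w _; rewrite lee_fin qf_mexp_ge0.
rewrite -mulrDr EFinM qfZ; apply: lee_wpmul2l; first by rewrite lee_fin expR_ge0.
exact: integral_qf_mexp_le.
Qed.

End OneSummand.

(** * Independence *)

Section IndependentPair.
Context d d1 d2 (Omega : measurableType d) (T1 : measurableType d1)
  (T2 : measurableType d2) (R : realType) (P : probability Omega R).
Variables (X1 : {mfun Omega >-> T1}) (X2 : {mfun Omega >-> T2}).
Hypothesis indep : forall A B, measurable A -> measurable B ->
  P (X1 @^-1` A `&` X2 @^-1` B) = (P (X1 @^-1` A) * P (X2 @^-1` B))%E.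

Lemma integral_independent_pair (F : T1 * T2 -> \bar R) :
  measurable_fun setT F -> (forall z, (0 <= F z)%E) ->
  (\int[P]_w F (X1 w, X2 w) = \int[P]_w1 \int[P]_w2 F (X1 w1, X2 w2))%E.
Proof.
move=> mF F0.
have mX : measurable_fun setT (fun w => (X1 w, X2 w)).
  by apply/measurable_fun_pairP; split; exact: measurable_funPT.
pose X := HB.pack_for {mfun Omega >-> (T1 * T2)%type} (fun w => (X1 w, X2 w))
  (isMeasurableFun.Build _ _ _ _ _ mX).
pose m1 := distribution P X1; pose m2 := distribution P X2.
have e : forall A, measurable A -> (m1 \x m2)%E A = distribution P X A.
  apply: product_measure_unique => A B mA mB.
  by rewrite /m1 /m2 /distribution /pushforward -indep.
transitivity (\int[distribution P X]_z F z)%E.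
  by rewrite ge0_integral_pushforward.
transitivity (\int[m1 \x m2]_z F z)%E.
  by apply: eq_measure_integral => A mA _; symmetry; exact: e.
rewrite fubini_tonelli1 // ge0_integral_pushforward //; last 2 first.
- exact: measurable_fun_fubini_tonelli_F.
- by move=> x _; apply: integral_ge0.
apply: eq_integral => w _ /=; rewrite /fubini_F ge0_integral_pushforward //.
exact/measurableT_comp.
Qed.

End IndependentPair.

Section IndependentFamily.
Context d (Omega : measurableType d) (R : realType) (P : probability Omega R).
Variables (n : nat) (F : 'I_n -> set (set Omega)).
Hypothesis FS : forall i, sigma_algebra setT (F i).
Hypothesis Fm : forall i, F i `<=` measurable.
Hypothesis indep : forall E : 'I_n -> set Omega, (forall i, F i (E i)) ->
  P (\bigcap_(i in [set: 'I_n]) E i) = (\prod_(i < n) P (E i))%E.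

(* A pi-system generating the sigma-algebra of the variables before [k]. *)
Definition past (k : 'I_n) : set (set Omega) :=
  [set A | exists2 E : 'I_n -> set Omega,
     (forall i, F i (E i)) /\ (forall i : 'I_n, (k <= i)%N -> E i = setT) &
     A = \bigcap_(i in [set: 'I_n]) E i].

Lemma FT i : F i setT.
Proof. by have [h0 hC _] := FS i; rewrite -(setD0 setT); exact: hC. Qed.

Lemma FI i A B : F i A -> F i B -> F i (A `&` B).
Proof.
move=> hA hB; have : <<s F i >> (A `&` B).
  by apply: (@measurableI _ (g_sigma_algebraType (F i))); exact: sub_sigma_algebra.
by rewrite sigma_algebra_id.
Qed.

Lemma past_setT k : past k setT.
Proof.
exists (fun=> setT); first by split => // i; exact: FT.
by rewrite bigcapT.
Qed.

Lemma past_measurable k : past k `<=` measurable.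
Proof.
move=> _ [E [FE _] ->]; apply: fin_bigcap_measurable => // i _.
by apply: Fm; exact: FE.
Qed.

Lemma past_setI k : setI_closed (past k).
Proof.
move=> _ _ [E [FE1 FE2] ->] [E' [FE1' FE2'] ->].
exists (fun i => E i `&` E' i); last by rewrite bigcapI.
split=> [i|i ki]; first by apply: FI.
by rewrite FE2 // FE2' // setIT.
Qed.

Lemma past_sub (k i : 'I_n) A : (i < k)%N -> F i A -> past k A.
Proof.
move=> ik FA; exists (fun j => if j == i then A else setT).
  split=> [j|j kj]; first by case: eqP => [->|_] //; exact: FT.
  by case: eqP => // ji; move: kj; rewrite ji leqNgt ik.
apply/seteqP; split => [w Aw j _|w /(_ i Logic.I)]; last by rewrite eqxx.
by case: eqP.
Qed.

Lemma indep_past k A D : <<s past k >> A -> F k D -> P (A `&` D) = (P A * P D)%E.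
Proof.
move=> hA FD; have mD := Fm FD.
have PD0 : 0 <= fine (P D) by apply: fine_ge0.
pose m2 : {measure set Omega -> \bar R} := mscale (NngNum PD0) P.
have := @g_sigma_algebra_measure_unique _ _ _ (past k) (@past_measurable k)
  (fun=> setT) (fun=> past_setT k) _ (mrestr P mD) m2 (@past_setI k) _ _ A hA.
have fP : (fine (P D))%:E = P D by rewrite fineK // fin_num_measure.
have m2E B : m2 B = (P D * P B)%E by rewrite /m2 /= /mscale /= fP.
rewrite m2E /= /mrestr (muleC (P A)); apply.
- by rewrite bigcup_const //; exists 0%N.
- move=> _ [E [FE1 FE2] ->]; rewrite -/m2 m2E.
  pose E' i := if i == k then D else E i.
  have -> : \bigcap_(i in [set: 'I_n]) E i `&` D = \bigcap_(i in [set: 'I_n]) E' i.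
    apply/seteqP; split => [w [Ew Dw] i _|w E'w].
      by rewrite /E'; case: eqP => // _; exact: Ew.
    have Dw : D w by have := E'w k Logic.I; rewrite /E' eqxx.
    split => // i _; have := E'w i Logic.I; rewrite /E'; case: eqP => // -> _.
    by rewrite FE2.
  rewrite !indep // => [|i]; last by rewrite /E'; case: eqP => [->|].
  rewrite (bigD1 k) //= [in RHS](bigD1 k) //= (FE2 k) // probability_setT mul1e.
  rewrite /E' eqxx; congr (_ * _)%E; apply: eq_bigr => i ik.
  by rewrite (negbTE ik).
- move=> _; apply: (le_lt_trans (probability_le1 _ _)) => //.
    exact: measurableI.
  exact: ltry.
Qed.

Lemma integral_past k
  (Phi : g_sigma_algebraType (past k) * g_sigma_algebraType (F k) -> \bar R) :
  measurable_fun setT Phi -> (forall z, (0 <= Phi z)%E) ->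
  (\int[P]_w Phi (w, w) = \int[P]_w1 \int[P]_w2 Phi (w1, w2))%E.
Proof.
move=> mPhi Phi0.
have sub_m (G : set (set Omega)) : G `<=` measurable ->
    measurable_fun setT (id : Omega -> g_sigma_algebraType G).
  move=> Gm _ A mA; rewrite setTI; move: A mA; apply: smallest_sub => //.
  exact: sigma_algebra_measurable.
have m1 := sub_m _ (@past_measurable k).
have m2 := sub_m _ (@Fm k).
pose X1 := HB.pack_for {mfun Omega >-> g_sigma_algebraType (past k)}
  (id : Omega -> g_sigma_algebraType (past k)) (isMeasurableFun.Build _ _ _ _ _ m1).
pose X2 := HB.pack_for {mfun Omega >-> g_sigma_algebraType (F k)}
  (id : Omega -> g_sigma_algebraType (F k)) (isMeasurableFun.Build _ _ _ _ _ m2).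
apply: (@integral_independent_pair _ _ _ _ _ _ _ P X1 X2) => // A B mA mB.
apply: (@indep_past k); first exact: mA.
by have : <<s F k >> B by []; rewrite sigma_algebra_id.
Qed.

End IndependentFamily.

Lemma mx_measurable_comp d d' (S : measurableType d) (S' : measurableType d')
  (R : realType) n (M : S -> 'M[R[i]]_n) (f : S' -> S) :
  measurable_fun setT f -> mx_measurable M -> mx_measurable (fun w => M (f w)).
Proof.
move=> mf mM i j; have [m1 m2] := mM i j.
by split; [exact: (measurableT_comp m1 mf) | exact: (measurableT_comp m2 mf)].
Qed.

Section Decoupling.
Context d (Omega : measurableType d) (R : realType) (P : probability Omega R).
Variables (n : nat) (F : 'I_n -> set (set Omega)).
Hypothesis FS : forall i, sigma_algebra setT (F i).
Hypothesis Fm : forall i, F i `<=` measurable.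
Hypothesis indep : forall E : 'I_n -> set Omega, (forall i, F i (E i)) ->
  P (\bigcap_(i in [set: 'I_n]) E i) = (\prod_(i < n) P (E i))%E.
Variables (N : nat) (M : 'I_n -> Omega -> 'M[R[i]]_N) (B : 'I_n -> 'M[R[i]]_N).
Hypothesis hM : forall i w, hadj (M i w) = M i w.
Hypothesis hB : forall i, hadj (B i) = B i.
Hypothesis mM : forall i,
  mx_measurable (M i : g_sigma_algebraType (F i) -> 'M[R[i]]_N).
Hypothesis one_summand : forall i (H : 'M[R[i]]_N), hadj H = H ->
  (\int[P]_w (rtr (mexp (H + M i w)))%:E <= (rtr (mexp (H + B i)))%:E)%E.

(* The summands are replaced one at a time, starting from the last. *)
Definition hybrid (k : nat) (w : Omega) : 'M[R[i]]_N :=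
  \sum_(i < n) (if (i < k)%N then M i w else B i).

Lemma hybrid_step k : (k < n)%N ->
  (\int[P]_w (rtr (mexp (hybrid k.+1 w)))%:E <=
   \int[P]_w (rtr (mexp (hybrid k w)))%:E)%E.
Proof.
move=> kn; pose k0 := Ordinal kn.
pose L w := \sum_(i < n | i != k0) (if (i < k)%N then M i w else B i).
have hyb1 w : hybrid k.+1 w = L w + M k0 w.
  rewrite /hybrid (bigD1 k0) //= ltnSn addrC; congr (_ + _).
  apply: eq_bigr => i ik; rewrite ltnS leq_eqVlt.
  have -> // : (i == k :> nat) = false.
  by apply: contraNF ik => /eqP ik; apply/eqP/val_inj.
have hyb0 w : hybrid k w = L w + B k0.
  by rewrite /hybrid (bigD1 k0) //= ltnn addrC.
have hL w : hadj (L w) = L w.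
  by rewrite /L hadj_sum; apply: eq_bigr => i _; case: ifP.
have past_m (i : 'I_n) : (i < k)%N ->
    mx_measurable (M i : g_sigma_algebraType (past F k0) -> 'M[R[i]]_N).
  move=> ik; apply: (@mx_measurable_comp _ _ (g_sigma_algebraType (F i))
    (g_sigma_algebraType (past F k0)) _ _ _ id _ (mM i)).
  move=> _ A mA; rewrite setTI; apply: sub_sigma_algebra.
  apply: (past_sub FS (i := i)) => //.
  by have : <<s F i >> A by []; rewrite sigma_algebra_id.
have mL : mx_measurable (L : g_sigma_algebraType (past F k0) -> 'M[R[i]]_N).
  apply: mx_measurable_sum => i _; have [ik|_] := boolP (i < k)%N.
    exact: past_m.
  exact: mx_measurable_cst.
pose Phi (z : g_sigma_algebraType (past F k0) * g_sigma_algebraType (F k0)) :=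
  (rtr (mexp (L z.1 + M k0 z.2)))%:E.
have mPhi : measurable_fun setT Phi.
  apply/measurable_EFinP/measurable_rtr_mexp.
    by move=> z; rewrite hadjD hL hM.
  apply: mx_measurableD.
    apply: (mx_measurable_comp _ mL); exact: measurable_fst.
  apply: (mx_measurable_comp _ (mM k0)); exact: measurable_snd.
under eq_integral do rewrite hyb1.
under [leRHS]eq_integral do rewrite hyb0.
have -> : (\int[P]_w (rtr (mexp (L w + M k0 w)))%:E =
    \int[P]_w1 \int[P]_w2 Phi (w1, w2))%E.
  apply: (integral_past FS Fm indep mPhi) => z.
  by rewrite lee_fin rtr_mexp_ge0.
have id_m : measurable_fun setT (id : Omega -> g_sigma_algebraType (past F k0)).
  move=> _ A mA; rewrite setTI; move: A mA; apply: smallest_sub.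
    exact: sigma_algebra_measurable.
  exact: (past_measurable Fm).
have id_F : measurable_fun setT (id : Omega -> g_sigma_algebraType (F k0)).
  move=> _ A mA; rewrite setTI; move: A mA; apply: smallest_sub.
    exact: sigma_algebra_measurable.
  exact: Fm.
have mLO : mx_measurable L by exact: (mx_measurable_comp id_m mL).
have mMO : mx_measurable (M k0) by exact: (mx_measurable_comp id_F (mM k0)).
apply: ge0_le_integral => //.
- by move=> w _; apply: integral_ge0 => w2 _; rewrite lee_fin rtr_mexp_ge0.
- pose Phi' (z : Omega * Omega) := (rtr (mexp (L z.1 + M k0 z.2)))%:E.
  apply: (@measurable_fun_fubini_tonelli_F _ _ _ _ _ P Phi') => [|z].
    apply/measurable_EFinP/measurable_rtr_mexp.
      by move=> z; rewrite hadjD hL hM.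
    apply: mx_measurableD.
      apply: (mx_measurable_comp _ mLO); exact: measurable_fst.
    apply: (mx_measurable_comp _ mMO); exact: measurable_snd.
  by rewrite lee_fin rtr_mexp_ge0.
- apply/measurable_EFinP/measurable_rtr_mexp.
    by move=> z; rewrite hadjD hL hB.
  by apply: mx_measurableD => //; exact: mx_measurable_cst.
- by move=> w _; rewrite /Phi /=; exact: (one_summand k0 (hL w)).
Qed.

Theorem integral_rtr_mexp_sum_le :
  (\int[P]_w (rtr (mexp (\sum_(i < n) M i w)))%:E <=
   (rtr (mexp (\sum_(i < n) B i)))%:E)%E.
Proof.
have claim k : (k <= n)%N ->
    (\int[P]_w (rtr (mexp (hybrid k w)))%:E <= (rtr (mexp (\sum_(i < n) B i)))%:E)%E.
  elim: k => [_|k IH kn]; last exact: le_trans (hybrid_step kn) (IH (ltnW kn)).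
  under eq_integral do rewrite /hybrid /=.
  by rewrite integral_cst //= probability_setT mule1.
have := claim n (leqnn n); under eq_integral => w _.
  by rewrite /hybrid; under eq_bigr do rewrite ltn_ord; over.
by [].
Qed.

End Decoupling.

Lemma bcirc_inj (R : realType) m p' (X Y : tensor R m p'.+1) : bcirc X = bcirc Y -> X = Y.
Proof.
move=> e; apply/ffunP => k; apply/matrixP => a b.
have := congr1 (fun Z : 'M[R[i]]_(m * p'.+1) => Z (flat (k, a)) (flat (0, b))) e.
by rewrite /= !bcircE !outer_flat !inner_flat subr0.
Qed.

Lemma tpow1 (R : realType) m p' (X : tensor R m p'.+1) : tpow X 1 = X.
Proof. by apply: bcirc_inj; rewrite bcirc_tpow expr1. Qed.

Lemma qf_sqr_ge0 (R : realType) n (K : 'M[R[i]]_n) u : hadj K = K -> 0 <= qf u (K ^+ 2).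
Proof.
move=> /spectralE [hU ->]; rewrite specX // qf_spec.
by apply: sumr_ge0 => j _; rewrite mulr_ge0 ?nsq_ge0 ?sqr_ge0.
Qed.

(** * Tail bound *)

Section Assembly.
Context (R : realType) (d : measure_display) (Omega : measurableType d).
Variables (P : probability Omega R) (m p' : nat).
Local Notation p := (p'.+1).
Local Notation C := (R[i]).
Local Notation Re := (@complex.Re R).
Local Notation Im := (@complex.Im R).

Lemma qf_sumE n (u : 'rV[C]_n) (M : 'M[C]_n) : qf u M =
  \sum_j \sum_i (Re (u 0 i * Num.conj (u 0 j)) * Re (M i j) +
                 - Im (u 0 i * Num.conj (u 0 j)) * Im (M i j)).
Proof.
rewrite /qf mxE Re_sum; apply: eq_bigr => j _.
rewrite mxE mulr_suml Re_sum; apply: eq_bigr => i _.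
by rewrite !mxE -mulrA (mulrC (M i j)) mulrA Re_mul mulNr.
Qed.

Lemma has_expectation_qf_bcirc (Y : Omega -> tensor R m p) u : tintegrable P Y ->
  has_expectation P (fun w => qf u (bcirc (Y w))) (qf u (bcirc (texp P Y))).
Proof.
move=> hY; rewrite qf_sumE; under eq_fun do rewrite qf_sumE.
apply: has_expectation_sum => j; apply: has_expectation_sum => i.
have [h1 h2] := hY (outer i - outer j) (inner i) (inner j).
apply: has_expectationD; apply: has_expectationZ.
  rewrite bcircE ffunE mxE /=; under eq_fun do rewrite bcircE.
  exact: has_expectation_integrable.
rewrite bcircE ffunE mxE /=; under eq_fun do rewrite bcircE.
exact: has_expectation_integrable.
Qed.

Lemma tsigma_sigma_algebra (Y : Omega -> tensor R m p) :
  sigma_algebra setT (tsigma Y).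
Proof. exact: smallest_sigma_algebra. Qed.

Lemma tsigma_measurable (Y : Omega -> tensor R m p) : tmeasurable Y ->
  tsigma Y `<=` measurable.
Proof.
move=> mY; apply: smallest_sub; first exact: sigma_algebra_measurable.
move=> _ [k [a [b [D [mD [->|->]]]]]]; rewrite -[X in measurable X]setTI.
  exact: (mY k a b).1.
exact: (mY k a b).2.
Qed.

Lemma mx_measurable_bcirc_tsigma (Y : Omega -> tensor R m p) :
  mx_measurable
    ((fun w => bcirc (Y w)) : g_sigma_algebraType (tsigma Y) -> 'M[C]_(m * p)).
Proof.
move=> i j; split; under eq_fun do rewrite bcircE; move=> _ D mD; rewrite setTI;
  do 2!apply: sub_sigma_algebra;
  exists (outer i - outer j), (inner i), (inner j), D; split => //.
- by left.
- by right.
Qed.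

Lemma mx_measurable_bcirc (Y : Omega -> tensor R m p) : tmeasurable Y ->
  mx_measurable (fun w => bcirc (Y w)).
Proof.
move=> mY i j; have [h1 h2] := mY (outer i - outer j) (inner i) (inner j).
by split; under eq_fun do rewrite bcircE.
Qed.

Lemma tle_qf (Y Z : tensor R m p) u : tle Y Z -> qf u (bcirc Y) <= qf u (bcirc Z).
Proof.
move=> [_ /(_ u)/complex_ge0 h].
have {}h : 0 <= qf u (bcirc Z - bcirc Y) by rewrite -bcircB.
by rewrite -(subrK (bcirc Y) (bcirc Z)) qfD lerDr.
Qed.

Variables (n : nat) (T : R) (A : 'I_n -> tensor R m p).
Variable X : 'I_n -> Omega -> tensor R m p.
Hypotheses (m0 : (0 < m)%N) (T0 : 0 < T).
Hypothesis hA : forall i, thermitian (A i).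
Hypothesis hX : forall i w, thermitian (X i w).
Hypothesis mX : forall i, tmeasurable (X i).
Hypothesis iX : forall i k, (0 < k)%N -> tintegrable P (fun w => tpow (X i w) k).
Hypothesis indepX : tindependent P X.
Hypothesis EX : forall i, texp P (X i) = 0.
Hypothesis EXk : forall i k, (2 <= k)%N ->
     tle (texp P (fun w => tpow (X i w) k))
         (((k`!)%:R * T ^+ (k - 2) / 2)%:C *: tpow (A i) 2).

Local Notation S w := (\sum_(i < n) X i w).
Local Notation V := (\sum_(i < n) tpow (A i) 2).

Let hS w : hadj (bcirc (S w)) = bcirc (S w).
Proof.
rewrite bcirc_sum hadj_sum; apply: eq_bigr => i _.
exact: bcirc_hermitian.
Qed.

Let mS : mx_measurable (fun w => bcirc (S w)).
Proof.
under eq_fun do rewrite bcirc_sum.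
by apply: mx_measurable_sum => i _; exact: mx_measurable_bcirc.
Qed.

Let hA2 i : hadj (bcirc (tpow (A i) 2)) = bcirc (tpow (A i) 2).
Proof. by rewrite bcirc_tpow hadjX // bcirc_hermitian. Qed.

Let hV : hadj (bcirc V) = bcirc V.
Proof. by rewrite bcirc_sum hadj_sum; apply: eq_bigr => i _. Qed.

Lemma moment_generating_bound t : 0 <= t -> t * T < 1 ->
  (\int[P]_w (rtr (mexp (t%:C *: bcirc (S w))))%:E <=
   (rtr (mexp ((t ^+ 2 / (2 * (1 - t * T)))%:C *: bcirc V)))%:E)%E.
Proof.
move=> t0 tT; set g := _ / _.
rewrite bcirc_sum scaler_sumr.
under eq_integral do rewrite bcirc_sum scaler_sumr.
apply: (@integral_rtr_mexp_sum_le _ _ _ _ _ (fun i => tsigma (X i))).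
- by move=> i; exact: tsigma_sigma_algebra.
- by move=> i; exact: tsigma_measurable.
- exact: indepX.
- by move=> i w; rewrite hadjZ bcirc_hermitian.
- by move=> i; rewrite hadjZ hA2.
- by move=> i; apply: mx_measurableZ; exact: mx_measurable_bcirc_tsigma.
move=> i H hH; apply: (integral_rtr_mexp_le (T := T)) => //.
- by move=> w; rewrite bcirc_hermitian.
- exact: mx_measurable_bcirc.
- by move=> u; rewrite bcirc_tpow qf_sqr_ge0 // bcirc_hermitian.
- exact: ltW.
- move=> u; have q0 : qf u (bcirc (texp P (X i))) = 0.
    by rewrite EX bcirc0 /qf mulmx0 mul0mx mxE.
  rewrite -q0; apply: has_expectation_qf_bcirc.
  have -> : X i = (fun w => tpow (X i w) 1) by apply/funext => w; rewrite tpow1.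
  exact: iX.
- move=> k u k2; exists (qf u (bcirc (texp P (fun w => tpow (X i w) k)))).
    under eq_fun do rewrite -bcirc_tpow.
    by apply: has_expectation_qf_bcirc; apply: iX; exact: ltnW.
  by have := tle_qf u (EXk i k2); rewrite bcircZ qfZ.
Qed.

Lemma tail_event_measurable theta :
  measurable [set w | (theta <= tlmax (S w))%R].
Proof.
have mp0 : (0 < m * p)%N by rewrite muln_gt0 m0.
have -> : [set w | theta <= tlmax (S w)] = \bigcap_k
   [set w | expR (k%:R * theta) <= rtr (mexp ((k%:R)%:C *: bcirc (S w)))].
  apply/seteqP; split => w.
    by move=> /(lambda_max_geP mp0 _ (hS w)) h k _; exact: h.
  by move=> h; apply/(lambda_max_geP mp0 _ (hS w)) => k; exact: h.
apply: bigcapT_measurable => k.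
have mf : measurable_fun setT (fun w => rtr (mexp ((k%:R)%:C *: bcirc (S w)))).
  apply: measurable_rtr_mexp; last exact: mx_measurableZ.
  by move=> w; rewrite hadjZ hS.
have := mf measurableT _ (measurable_itv `[expR (k%:R * theta), +oo[).
rewrite setTI; congr measurable.
by apply/seteqP; split => w; rewrite /= in_itv /= andbT.
Qed.

Lemma tail_bound t theta : 0 <= t -> t * T < 1 ->
  (P [set w | (theta <= tlmax (S w))%R] <=
   ((m * p)%:R * expR (t ^+ 2 / (2 * (1 - t * T)) * tnorm V - t * theta))%:E)%E.
Proof.
move=> t0 tT; have mp0 : (0 < m * p)%N by rewrite muln_gt0 m0.
set E := [set w | _]; have mE : measurable E by exact: tail_event_measurable.
set g := _ / _; have g0 : 0 <= g.
  by rewrite divr_ge0 ?sqr_ge0 // mulr_ge0 // subr_ge0 ltW.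
have mf : measurable_fun setT (fun w => (rtr (mexp (t%:C *: bcirc (S w))))%:E).
  apply/measurable_EFinP/measurable_rtr_mexp; last exact: mx_measurableZ.
  by move=> w; rewrite hadjZ hS.
have h1 : ((expR (t * theta))%:E * P E <=
    \int[P]_w (rtr (mexp (t%:C *: bcirc (S w))))%:E)%E.
  rewrite -integral_cst //.
  apply: (@le_trans _ _ (\int[P]_(w in E) (rtr (mexp (t%:C *: bcirc (S w))))%:E)%E).
    apply: ge0_le_integral => //.
    - by move=> w _; rewrite lee_fin expR_ge0.
    - exact: measurable_funS mf.
    - move=> w Ew; rewrite lee_fin; apply: le_trans (expR_lambda_max_le mp0 _ (hS w)).
      by rewrite ler_expR ler_wpM2l.
  by apply: ge0_subset_integral => // w _; rewrite lee_fin rtr_mexp_ge0.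
have h2 := le_trans h1 (moment_generating_bound t0 tT).
rewrite expRD expRN mulrA EFinM lee_pdivlMr ?expR_gt0 //.
rewrite muleC; apply: le_trans h2 _; rewrite lee_fin.
apply: le_trans (rtr_mexp_le mp0 hV g0) _.
rewrite ler_wpM2l // ler_expR ler_wpM2l //.
exact: lambda_max_le_norm.
Qed.

End Assembly.

Section TailExponent.
Variable R : realType.
Implicit Types T s theta : R.

Lemma bernstein_exponent T s theta : 0 < T -> 0 <= s -> 0 < theta ->
  exists t, [/\ 0 <= t, t * T < 1 &
    t ^+ 2 / (2 * (1 - t * T)) * s - t * theta =
    - (theta ^+ 2 / 2) / (s + T * theta)].
Proof.
move=> T0 s0 th0; have Tth : 0 < T * theta by exact: mulr_gt0.
have [s_eq0|s_neq0] := eqVneq s 0.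
  exists (2 * T)^-1; split.
  - by rewrite invr_ge0 mulr_ge0 // ltW.
  - have -> : (2 * T)^-1 * T = 2^-1 by field; rewrite gt_eqF.
    by rewrite invf_lt1 // ltr1n.
  - by rewrite s_eq0 mulr0 sub0r add0r; field; rewrite !gt_eqF.
have {s0 s_neq0}s0 : 0 < s by rewrite lt_neqAle eq_sym s_neq0.
have D0 : 0 < s + T * theta by exact: addr_gt0.
have e : 1 - theta / (s + T * theta) * T = s / (s + T * theta).
  by field; rewrite gt_eqF.
exists (theta / (s + T * theta)); split.
- by rewrite divr_ge0 // ltW.
- by rewrite -subr_gt0 e divr_gt0.
- by rewrite e; field; rewrite !gt_eqF.
Qed.

Lemma exponent_small_le T s theta : 0 < T -> 0 <= s -> 0 <= theta ->
  theta <= s / T ->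
  - (theta ^+ 2 / 2) / (s + T * theta) <= - theta ^+ 2 / (4 * s).
Proof.
move=> T0 s0 th0; rewrite ler_pdivlMr // => h.
have [->|th] := eqVneq theta 0; first by rewrite expr0n !(mul0r, oppr0).
have {}th0 : 0 < theta by rewrite lt_neqAle eq_sym th.
have sp : 0 < s by apply: lt_le_trans h; exact: mulr_gt0.
rewrite !mulNr lerN2 -[_ / 2 / _]mulrA -invfM ler_pM2l ?exprn_gt0 //.
rewrite lef_pV2 ?posrE ?mulr_gt0 // ?addr_gt0 ?mulr_gt0 //.
by rewrite (mulrC T); lra.
Qed.

Lemma exponent_large_le T s theta : 0 < T -> 0 <= s -> 0 <= theta ->
  s / T <= theta ->
  - (theta ^+ 2 / 2) / (s + T * theta) <= - theta / (4 * T).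
Proof.
move=> T0 s0 th0; rewrite ler_pdivrMr // => h.
have [->|th] := eqVneq theta 0; first by rewrite expr0n !(mul0r, oppr0).
have {}th0 : 0 < theta by rewrite lt_neqAle eq_sym th.
have Tth : 0 < T * theta by exact: mulr_gt0.
have D0 : 0 < s + T * theta by exact: ltr_wpDl.
rewrite !mulNr lerN2 -[_ / 2 / _]mulrA -invfM expr2 -mulrA ler_pM2l //.
rewrite -div1r ler_pdivrMr ?mulr_gt0 // mulrAC ler_pdivlMr ?mulr_gt0 //.
by rewrite mul1r mulrCA (mulrC theta T) in h *; lra.
Qed.

End TailExponent.

Theorem theorem8 (R : realType) (d : measure_display) (Omega : measurableType d)
  (P : probability Omega R) (m p n : nat) (T : R)
  (A : 'I_n -> tensor R m p) (X : 'I_n -> Omega -> tensor R m p) :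
  (0 < m)%N -> (0 < p)%N -> (0 < n)%N -> 0 < T ->
  (forall i, thermitian (A i)) ->
  (forall i w, thermitian (X i w)) ->
  (forall i, tmeasurable (X i)) ->
  (forall i k, (0 < k)%N -> tintegrable P (fun w => tpow (X i w) k)) ->
  tindependent P X ->
  (forall i, texp P (X i) = 0) ->
  (forall i k, (2 <= k)%N ->
     tle (texp P (fun w => tpow (X i w) k))
         (((k`!)%:R * T ^+ (k - 2) / 2)%:C *: tpow (A i) 2)) ->
  let sigma2 := tnorm (\sum_(i < n) tpow (A i) 2) in
  forall theta : R, 0 <= theta ->
    (P [set w | (theta <= tlmax (\sum_(i < n) X i w))%R]
       <= ((m * p)%:R * expR (- (theta ^+ 2 / 2) / (sigma2 + T * theta)))%:E)%E /\
    (theta <= sigma2 / T ->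
     (P [set w | (theta <= tlmax (\sum_(i < n) X i w))%R]
       <= ((m * p)%:R * expR (- theta ^+ 2 / (4 * sigma2)))%:E)%E) /\
    (sigma2 / T <= theta ->
     (P [set w | (theta <= tlmax (\sum_(i < n) X i w))%R]
       <= ((m * p)%:R * expR (- theta / (4 * T)))%:E)%E).
Proof.
case: p A X => [|p'] A X m0 // _ n0 T0 hA hX mX iX indepX EX EXk s theta th0.
have s0 : 0 <= s by exact: sqrtr_ge0.
have mp1 : 1 <= (m * p'.+1)%:R :> R by rewrite ler1n muln_gt0 m0.
have main : (P [set w | (theta <= tlmax (\sum_(i < n) X i w))%R] <=
    ((m * p'.+1)%:R * expR (- (theta ^+ 2 / 2) / (s + T * theta)))%:E)%E.
  have [th|th] := eqVneq theta 0.
    rewrite th expr0n /= !mul0r oppr0 mul0r expR0 mulr1.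
    apply: (@le_trans _ _ 1%E); last by rewrite lee_fin.
    by apply: probability_le1; exact: (tail_event_measurable m0 hX mX).
  have [|t [t0 tT <-]] := bernstein_exponent T0 s0 (theta := theta).
    by rewrite lt_neqAle eq_sym th.
  exact: (tail_bound m0 T0 hA hX mX iX indepX EX EXk theta t0 tT).
split => //; split => hth; apply: (le_trans main).
  by rewrite lee_fin ler_wpM2l // ler_expR exponent_small_le.
by rewrite lee_fin ler_wpM2l // ler_expR exponent_large_le.
Qed.
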